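(* The functor $\mathbf{RSBS}\to\mathbf{RSS}$, $E\mapsto\mathsf{PG}(\mathbf P(E))$, is a left adjoint to the forgetful functor $\mathbf{RSS}\to\mathbf{RSBS}$, $S\mapsto\mathbf E(S)$, and $\mathbf{RSBS}$ is coreflective in $\mathbf{RSS}$.
   Context: Maps (other than functors) are written to the right of their arguments and composed left to right. REGULAR $*$-SEMIGROUPS. A regular $*$-semigroup is a semigroup with a unary operation satisfying $(a^* )^*=a=aa^*a$, $(ab)^*=b^*a^*$. $\mathbf{RSS}$ is the category of regular $*$-semigroups with $*$-morphisms (semigroup homomorphisms preserving $^*$). PROJECTION ALGEBRAS. A projection algebra is a set $P$ with unary operations $\theta_p:P\to P$ ($p\in P$) such that for all $p,q\in P$: $p\theta_p=p$; $\theta_p\theta_p=\theta_p$; $p\theta_q\theta_p=q\theta_p$; $\theta_p\theta_q\theta_p=\theta_{q\theta_p}$; $\theta_p\theta_q\theta_p\theta_q=\theta_p\theta_q$. Morphisms are maps $\phi$ with $(p\theta_q)\phi=(p\phi)\theta_{q\phi}$. On $P$ define $p\leq_{\mathscr F}q$ iff $p=q\theta_p$; $p\mathrel{\mathscr F}q$ iff $p\leq_{\mathscr F}q$ and $q\leq_{\mathscr F}p$. THE SEMIGROUP $\mathsf{PG}(P)$. A $P$-path is a tuple $(p_1,\ldots,p_k)$ ($k\geq1$) with $p_1\mathrel{\mathscr F}\cdots\mathrel{\mathscr F}p_k$, regarded as a morphism $p_1\to p_k$; the path category $\mathscr P(P)$ consists of all $P$-paths under $(p_1,\ldots,p_k)\circ(p_k,\ldots,p_l)=(p_1,\ldots,p_k,\ldots,p_l)$.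 A pair $(e,f)\in P\times P$ is $p$-linked ($p\in P$) if $f=e\theta_p\theta_f$ and $e=f\theta_p\theta_e$. Let $\equiv$ be the (category) congruence on $\mathscr P(P)$ generated by all $((p,p),(p))$ with $p\in P$, all $((p,q,p),(p))$ with $p\mathrel{\mathscr F}q$, and all $((e,e\theta_p,f),(e,f\theta_p,f))$ with $p\in P$ and $(e,f)$ $p$-linked. The class of $(p_1,\ldots,p_k)$ is $[\![p_1,\ldots,p_k]\!]$. The regular $*$-semigroup $\mathsf{PG}(P)$ consists of all classes, with $[\![p_1,\ldots,p_k]\!]^*=[\![p_k,\ldots,p_1]\!]$ and $[\![p_1,\ldots,p_k]\!]\bullet[\![q_1,\ldots,q_l]\!]=[\![p_1',\ldots,p_k',q_1',\ldots,q_l']\!]$, where, with $p'=q_1\theta_{p_k}$ and $q'=p_k\theta_{q_1}$, $p_i'=p'\theta_{p_k}\cdots\theta_{p_i}$ and $q_j'=q'\theta_{q_1}\cdots\theta_{q_j}$. A projection algebra morphism $\phi:P\to P'$ induces the $*$-morphism $\mathsf{PG}(P)\to\mathsf{PG}(P')$, $[\![p_1,\ldots,p_k]\!]\mapsto[\![p_1\phi,\ldots,p_k\phi]\!]$. BOSETS. For a semigroup $S$ let $E=\mathbf E(S)=\{e\in S:e^2=e\}$ and $\mathrm{BP}(E)=\{(e,f)\in E\times E:\{e,f\}\cap\{ef,fe\}\neq\varnothing\}$; for $(e,f)\in\mathrm{BP}(E)$ one has $ef\in E$. The boset (biordered set) of $S$ is $E$ with the partial operation $(e,f)\mapsto ef$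 defined exactly on $\mathrm{BP}(E)$. A boset is a partial algebra arising as the boset of some semigroup; it is regular if it is the boset of some regular semigroup. In a boset write $e\leq_l f$ iff $e=ef$, and $e\leq_r f$ iff $e=fe$. For $e,f\in E$ let $\mathsf M(e,f)=\{g\in E:ge=g=fg\}$, pre-ordered by $h\preceq g$ iff $eh\leq_r eg$ and $hf\leq_l gf$; the sandwich set is $\mathsf S(e,f)=\{g\in\mathsf M(e,f):h\preceq g\text{ for all }h\in\mathsf M(e,f)\}$. A regular $*$-boset is a regular boset $E$ with a unary operation $^*$ such that: $(e^* )^*=e$; if $(e,f)\in\mathrm{BP}(E)$ then $(e^*,f^* )\in\mathrm{BP}(E)$ and $(ef)^*=f^*e^*$; and for every $e\in E$ there are $s,t\in E$ with $se=e$, $es=s$, $e^*t=t$, $te^*=e^*$, $et=e$, $te=t$, $se^*=s$, $e^*s=e^*$, and $e^*(gs)=(tg)e^*$ for all $g\in E$ with $g\leq_l e$ and $g\leq_r e$. $\mathbf{RSBS}$ is the category of regular $*$-bosets, with morphisms the maps $\phi:E\to E'$ such that $(e,f)\in\mathrm{BP}(E)$ implies $(e\phi,f\phi)\in\mathrm{BP}(E')$ and $(ef)\phi=(e\phi)(f\phi)$; $\mathsf S(e,f)\phi\subseteq\mathsf S(e\phi,f\phi)$ for all $e,f\in E$; and $(e^* )\phi=(e\phi)^*$. FUNCTORS. The forgetful functor $\mathbf{RSS}\to\mathbf{RSBS}$ sends $S$ to its boset $\mathbf E(S)$ with the restriction of $^*$, and a $*$-morphism to its restriction to idempotents. For a regular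 $*$-boset $E$, $\mathbf P(E)=\{p\in E:p=p^*\}$ is the projection algebra with $q\theta_p=p\,e(p,q)$, where $e(p,q)$ is the unique element $e\in\mathsf S(p,q)$ with $pe,eq\in\mathbf P(E)$ (such an element exists and is unique); a morphism $\phi:E\to E'$ in $\mathbf{RSBS}$ restricts to a projection algebra morphism $\mathbf P(E)\to\mathbf P(E')$. A category $\mathbf C$ is coreflective in $\mathbf D$ if it is isomorphic to a full subcategory of $\mathbf D$ whose inclusion functor has a right adjoint, i.e. there is a full embedding $\mathbf C\to\mathbf D$ (injective on objects and morphisms, with full image) that has a right adjoint. *)

(* Defs.v *)
#[warnings="-notation-overridden"]
From mathcomp Require Import all_boot.
From mathcomp Require Import boolp classical_sets.

Set Implicit Arguments.
Unset Strict Implicit.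
Unset Printing Implicit Defensive.

(** * Categories *)

(* Composition is written left to right: [comp f g] is "f, then g". *)
Record category := Category {
  obj :> Type;
  hom : obj -> obj -> Type;
  idm : forall a, hom a a;
  comp : forall a b c, hom a b -> hom b c -> hom a c;
  comp_idl : forall a b (f : hom a b), comp (idm a) f = f;
  comp_idr : forall a b (f : hom a b), comp f (idm b) = f;
  compA : forall a b c d (f : hom a b) (g : hom b c) (h : hom c d),
    comp f (comp g h) = comp (comp f g) h }.
Arguments hom {c} _ _ : rename.
Arguments idm {c} a : rename.
Arguments comp {c a b c0} _ _ : rename.

Record functor (C D : category) := Functor {
  fobj :> C -> D;
  fmap : forall a b : C, hom a b -> hom (fobj a) (fobj b);
  fmap_id : forall a : C, fmap (idm a) = idm (fobj a);
  fmap_comp : forall (a b c : C) (f : hom a b) (g : hom b c),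
    fmap (comp f g) = comp (fmap f) (fmap g) }.
Arguments fmap {C D} f {a b} _ : rename.

Section FunctorComposition.
Variables (B C D : category) (F : functor B C) (G : functor C D).

Lemma functor_comp_id a : fmap G (fmap F (idm a)) = idm (G (F a)).
Proof. by rewrite !fmap_id. Qed.

Lemma functor_comp_comp a b c (f : hom a b) (g : hom b c) :
  fmap G (fmap F (comp f g)) = comp (fmap G (fmap F f)) (fmap G (fmap F g)).
Proof. by rewrite !fmap_comp. Qed.

Definition functor_comp : functor B D :=
  Functor functor_comp_id functor_comp_comp.

End FunctorComposition.

Definition left_adjoint (C D : category) (F : functor C D) (G : functor D C) :
    Prop :=
  exists phi : forall (c : C) (d : D), hom (F c) d -> hom c (G d),
    (forall c d, bijective (@phi c d)) /\
    (forall (c c' : C) (d d' : D)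
        (f : hom c' c) (h : hom (F c) d) (g : hom d d'),
      phi c' d' (comp (comp (fmap F f) h) g)
        = comp (comp f (phi c d h)) (fmap G g)).

Definition isomorphic (C : category) (a b : C) : Prop :=
  exists (f : hom a b) (g : hom b a), comp f g = idm a /\ comp g f = idm b.

Definition faithful (C D : category) (F : functor C D) : Prop :=
  forall a b : C, injective (@fmap C D F a b).

Definition full (C D : category) (F : functor C D) : Prop :=
  forall (a b : C) (g : hom (F a) (F b)), exists f : hom a b, fmap F f = g.

Definition full_embedding (C D : category) (F : functor C D) : Prop :=
  [/\ injective (fobj F), faithful F & full F].

Definition coreflective (C D : category) : Prop :=
  exists I : functor C D,
    full_embedding I /\ exists G : functor D C, left_adjoint I G.

(* The same notions when structures are identified up to isomorphism.  This is
   the version that is meaningful when the objects are structures on arbitrary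
   types: [=] between two such objects contains an equality of types, about
   which type theory says nothing. *)
Definition full_embedding_iso (C D : category) (F : functor C D) : Prop :=
  [/\ (forall a b : C, isomorphic (F a) (F b) -> isomorphic a b),
      faithful F & full F].

Definition coreflective_iso (C D : category) : Prop :=
  exists I : functor C D,
    full_embedding_iso I /\ exists G : functor D C, left_adjoint I G.

Section InducedCategory.
Variables (C : category) (O : Type) (f : O -> C).

Definition induced_category : category :=
  @Category O (fun a b => hom (f a) (f b)) (fun a => idm (f a))
    (fun a b c => @comp C (f a) (f b) (f c))
    (fun a b => @comp_idl C (f a) (f b)) (fun a b => @comp_idr C (f a) (f b))
    (fun a b c d => @compA C (f a) (f b) (f c) (f d)).

End InducedCategory.

(** * Semigroups and regular *-semigroups *)

(* MathComp's [semigroupType] is not used: it bundles a choice operator with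
   the carrier, which would be extra data on the objects of the categories. *)
Record semigroup := Semigroup {
  sg_sort :> Type;
  sg_mul : sg_sort -> sg_sort -> sg_sort;
  sg_mulA : associative sg_mul }.

Definition regular_semigroup (S : semigroup) : Prop :=
  forall a : S, exists x : S, sg_mul (sg_mul a x) a = a.

Record rss_laws (T : Type) (mul : T -> T -> T) (star : T -> T) : Prop :=
  RssLaws {
    rss_lawA : associative mul;
    rss_lawK : forall a, star (star a) = a;
    rss_lawR : forall a, mul (mul a (star a)) a = a;
    rss_lawM : forall a b, star (mul a b) = mul (star b) (star a) }.

Record rss_on (T : Type) := RssOn {
  rss_on_mul : T -> T -> T;
  rss_on_star : T -> T;
  rss_onP : rss_laws rss_on_mul rss_on_star }.

Record rss := Rss { rss_sort :> Type; rss_str : rss_on rss_sort }.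

Definition rmul (S : rss) : S -> S -> S := rss_on_mul (rss_str S).
Definition rstar (S : rss) : S -> S := rss_on_star (rss_str S).
Section RssTheory.
Variable S : rss.
Implicit Types a b : S.
Lemma rmulA a b c : rmul a (rmul b c) = rmul (rmul a b) c.
Proof. exact: (rss_lawA (rss_onP (rss_str S))). Qed.
Lemma rstarK a : rstar (rstar a) = a.
Proof. exact: (rss_lawK (rss_onP (rss_str S))). Qed.
Lemma rmulR a : rmul (rmul a (rstar a)) a = a.
Proof. exact: (rss_lawR (rss_onP (rss_str S))). Qed.
Lemma rstarM a b : rstar (rmul a b) = rmul (rstar b) (rstar a).
Proof. exact: (rss_lawM (rss_onP (rss_str S))). Qed.
Definition rss_semigroup : semigroup := Semigroup rmulA.
End RssTheory.

Record rss_hom (S S' : rss) := RssHom {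
  rss_fun :> S -> S';
  rss_funM : forall a b, rss_fun (rmul a b) = rmul (rss_fun a) (rss_fun b);
  rss_funS : forall a, rss_fun (rstar a) = rstar (rss_fun a) }.

Lemma rss_hom_ext (S S' : rss) (f g : rss_hom S S') : f =1 g -> f = g.
Proof.
case: f g => [f fM fS] [g gM gS] /= /funext fg; subst g.
by rewrite (Prop_irrelevance fM gM) (Prop_irrelevance fS gS).
Qed.

Definition rss_id (S : rss) : rss_hom S S :=
  @RssHom S S id (fun _ _ => erefl) (fun _ => erefl).

Section RssComp.
Variables (A B C : rss) (f : rss_hom A B) (g : rss_hom B C).
Let h a := g (f a).
Lemma rss_compM a b : h (rmul a b) = rmul (h a) (h b).
Proof. by rewrite /h !rss_funM. Qed.
Lemma rss_compS a : h (rstar a) = rstar (h a).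
Proof. by rewrite /h !rss_funS. Qed.
Definition rss_comp : rss_hom A C := RssHom rss_compM rss_compS.
End RssComp.

Definition RSS : category.
Proof.
by refine (@Category rss rss_hom rss_id rss_comp _ _ _) => *; exact: rss_hom_ext.
Defined.

(** * Partial algebras and bosets *)

(* A partial operation is a map to [option T], [None] meaning "undefined". *)
Section PartialAlgebra.
Variables (T : Type) (m : T -> T -> option T).
Implicit Types e f g h : T.

Definition BP e f : Prop := exists g, m e f = Some g.
Definition le_l e f : Prop := m e f = Some e.
Definition le_r e f : Prop := m f e = Some e.

Definition in_M e f g : Prop := m g e = Some g /\ m f g = Some g.

Definition M_le e f h g : Prop :=
  exists eh eg hf gf,
    [/\ m e h = Some eh, m e g = Some eg, m h f = Some hf & m g f = Some gf] /\
    (le_r eh eg /\ le_l hf gf).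

Definition sandwich e f g : Prop :=
  in_M e f g /\ forall h, in_M e f h -> M_le e f h g.

End PartialAlgebra.

Section BosetOfSemigroup.
Variable S : semigroup.
Local Notation "a * b" := (sg_mul a b).

Definition idempotent := {e : S | e * e = e}.

Definition Idempotent (e : S) (ee : e * e = e) : idempotent := exist _ e ee.

Definition basic_pair (e f : S) : Prop :=
  (e * f = e \/ e * f = f) \/ (f * e = e \/ f * e = f).

Lemma basic_pair_idem (e f : idempotent) :
  basic_pair (sval e) (sval f) ->
  (sval e * sval f) * (sval e * sval f) = sval e * sval f.
Proof.
case: e f => [e ee] [f ff] /= [[->|->]|[fe|fe]] //.
- by rewrite sg_mulA -(sg_mulA e f e) fe ee.
- by rewrite sg_mulA -(sg_mulA e f e) fe -sg_mulA ff.
Qed.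

Definition idempotent_mul (e f : idempotent)
    (ef : basic_pair (sval e) (sval f)) : idempotent :=
  Idempotent (basic_pair_idem ef).

Definition boset_mul (e f : idempotent) : option idempotent :=
  match pselect (basic_pair (sval e) (sval f)) with
  | left ef => Some (idempotent_mul ef)
  | right _ => None
  end.

Lemma idempotent_inj (e f : idempotent) : sval e = sval f -> e = f.
Proof.
case: e f => [e ee] [f ff] /= ef; subst f.
by rewrite (Prop_irrelevance ee ff).
Qed.

Lemma boset_mulP (e f g : idempotent) :
  boset_mul e f = Some g <->
  basic_pair (sval e) (sval f) /\ sval g = sval e * sval f.
Proof.
rewrite /boset_mul; case: pselect => [ef|nef]; split=> //.
- by case=> <-.
- by case=> _ gef; congr Some; apply: idempotent_inj.
- by case=> /nef.
Qed.

Lemma boset_mulI (e f g : idempotent) :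
  sval e * sval f = sval g -> basic_pair (sval e) (sval f) ->
  boset_mul e f = Some g.
Proof. by move=> efg b; apply/boset_mulP. Qed.

End BosetOfSemigroup.

Definition is_boset_of (T : Type) (m : T -> T -> option T) (S : semigroup) :
    Prop :=
  exists i : T -> idempotent S,
    bijective i /\ forall e f, boset_mul (i e) (i f) = omap i (m e f).

Definition regular_boset (T : Type) (m : T -> T -> option T) : Prop :=
  exists S : semigroup, regular_semigroup S /\ is_boset_of m S.

(** * Regular *-bosets *)

(* In [rsb_lawE] an equation between (iterated) partial products means that
   both sides are defined and equal. *)
Record rsbs_laws (T : Type) (m : T -> T -> option T) (star : T -> T) : Prop :=
  RsbsLaws {
    rsb_lawB : regular_boset m;
    rsb_lawK : forall e, star (star e) = e;
    rsb_lawM : forall e f g,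
      m e f = Some g -> m (star f) (star e) = Some (star g);
    rsb_lawBP : forall e f, BP m e f -> BP m (star e) (star f);
    rsb_lawE : forall e, exists s t,
      [/\ m s e = Some e, m e s = Some s,
          m (star e) t = Some t & m t (star e) = Some (star e)] /\
      [/\ m e t = Some e, m t e = Some t,
          m s (star e) = Some s & m (star e) s = Some (star e)] /\
      (forall g, le_l m g e -> le_r m g e ->
        exists gs tg c, [/\ m g s = Some gs, m t g = Some tg,
          m (star e) gs = Some c & m tg (star e) = Some c]) }.

Record rsbs_on (T : Type) := RsbsOn {
  rsbs_on_mul : T -> T -> option T;
  rsbs_on_star : T -> T;
  rsbs_onP : rsbs_laws rsbs_on_mul rsbs_on_star }.

Record rsbs := Rsbs { rsbs_sort :> Type; rsbs_str : rsbs_on rsbs_sort }.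

Definition bmul (E : rsbs) : E -> E -> option E := rsbs_on_mul (rsbs_str E).
Definition bstar (E : rsbs) : E -> E := rsbs_on_star (rsbs_str E).

Record rsbs_hom (E E' : rsbs) := RsbsHom {
  rsbs_fun :> E -> E';
  rsbs_funM : forall e f g,
    bmul e f = Some g ->
    bmul (rsbs_fun e) (rsbs_fun f) = Some (rsbs_fun g);
  rsbs_funW : forall e f g,
    sandwich (@bmul E) e f g ->
    sandwich (@bmul E') (rsbs_fun e) (rsbs_fun f) (rsbs_fun g);
  rsbs_funS : forall e, rsbs_fun (bstar e) = bstar (rsbs_fun e) }.

Lemma rsbs_hom_ext (E E' : rsbs) (f g : rsbs_hom E E') : f =1 g -> f = g.
Proof.
case: f g => [f fM fW fS] [g gM gW gS] /= /funext fg; subst g.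
rewrite (Prop_irrelevance fM gM) (Prop_irrelevance fW gW).
by rewrite (Prop_irrelevance fS gS).
Qed.

Definition rsbs_id (E : rsbs) : rsbs_hom E E :=
  @RsbsHom E E id (fun _ _ _ => id) (fun _ _ _ => id) (fun _ => erefl).

Section RsbsComp.
Variables (A B C : rsbs) (f : rsbs_hom A B) (g : rsbs_hom B C).
Let h a := g (f a).
Lemma rsbs_compM a b c : bmul a b = Some c -> bmul (h a) (h b) = Some (h c).
Proof. by move=> ?; do 2 apply: rsbs_funM. Qed.
Lemma rsbs_compW a b c :
  sandwich (@bmul A) a b c -> sandwich (@bmul C) (h a) (h b) (h c).
Proof. by move=> ?; do 2 apply: rsbs_funW. Qed.
Lemma rsbs_compS a : h (bstar a) = bstar (h a).
Proof. by rewrite /h !rsbs_funS. Qed.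
Definition rsbs_comp : rsbs_hom A C := RsbsHom rsbs_compM rsbs_compW rsbs_compS.
End RsbsComp.

Definition RSBS : category.
Proof.
by refine (@Category rsbs rsbs_hom rsbs_id rsbs_comp _ _ _) => *;
  exact: rsbs_hom_ext.
Defined.

(** * The forgetful functor from RSS to RSBS *)

Section ForgetObject.
Variable S : rss.
Local Notation "a * b" := (rmul a b).
Local Notation E := (idempotent (rss_semigroup S)).
Local Notation m := (@boset_mul (rss_semigroup S)).

Lemma idem_starP (e : E) : rstar (sval e) * rstar (sval e) = rstar (sval e).
Proof. by rewrite -rstarM; congr rstar; exact: (svalP e). Qed.

Definition idem_star (e : E) : E :=
  Idempotent (S := rss_semigroup S) (idem_starP e).

Lemma basic_pair_star (e f : rss_semigroup S) :
  basic_pair e f -> basic_pair (S := rss_semigroup S) (rstar e) (rstar f).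
Proof. by rewrite /basic_pair /= -!rstarM; case=> [][->|->]; tauto. Qed.

Lemma basic_pairC (e f : rss_semigroup S) : basic_pair e f -> basic_pair f e.
Proof. by rewrite /basic_pair; tauto. Qed.

Lemma forget_laws : rsbs_laws m idem_star.
Proof.
split.
- exists (rss_semigroup S); split.
    by move=> a; exists (rstar a); exact: rmulR.
  exists id; split=> [|e f]; first by exists id.
  by case: boset_mul.
- by move=> e; apply: idempotent_inj; exact: rstarK.
- move=> e f g /boset_mulP[ef gE]; apply/boset_mulP; split.
    by apply/basic_pairC/basic_pair_star.
  by rewrite /= gE; exact: rstarM.
- move=> e f [g /boset_mulP[/basic_pair_star ef _]].
  exists (idempotent_mul (e := idem_star e) (f := idem_star f) ef).
  by apply/boset_mulP.
- case=> e ee; have ee' : e * e = e := ee.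
  have eK := rmulR e; have esK := rmulR (rstar e); rewrite rstarK in esK.
  have sP : (e * rstar e) * (e * rstar e) = e * rstar e by rewrite rmulA eK.
  have tP : (rstar e * e) * (rstar e * e) = rstar e * e by rewrite rmulA esK.
  have es_es : rstar e * rstar e = rstar e by rewrite -rstarM ee'.
  pose s : E := Idempotent (S := rss_semigroup S) sP.
  pose t : E := Idempotent (S := rss_semigroup S) tP.
  exists s, t.
  have H1 : e * (e * rstar e) = e * rstar e by rewrite rmulA ee'.
  have H2 : rstar e * (rstar e * e) = rstar e * e by rewrite rmulA es_es.
  have H3 : e * (rstar e * e) = e by rewrite rmulA.
  have H4 : (rstar e * e) * e = rstar e * e by rewrite -rmulA ee'.
  have H5 : (e * rstar e) * rstar e = e * rstar e by rewrite -rmulA es_es.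
  have H6 : rstar e * (e * rstar e) = rstar e by rewrite rmulA.
  split; [|split].
  + by split; apply: boset_mulI; rewrite /basic_pair /=; tauto.
  + by split; apply: boset_mulI; rewrite /basic_pair /=; tauto.
  + move=> [g gg] /boset_mulP[_ /= ge] /boset_mulP[_ /= eg].
    have gg' : g * g = g := gg.
    have sg : (e * rstar e) * g = g by rewrite {1}eg rmulA eK -eg.
    have gt : g * (rstar e * e) = g by rewrite {1}ge -rmulA H3 -ge.
    pose g' : E := exist _ g gg.
    have b1 : basic_pair (sval g') (sval s) by right; left.
    have b2 : basic_pair (sval t) (sval g') by right; right.
    pose gs : E := idempotent_mul b1.
    pose tg : E := idempotent_mul b2.
    have b3 : basic_pair (rstar e : rss_semigroup S) (sval gs).
      by right; right; rewrite /= -rmulA H5.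
    have b4 : basic_pair (sval tg) (rstar e : rss_semigroup S).
      by right; left; rewrite /= rmulA H2.
    exists gs, tg.
    exists (@idempotent_mul (rss_semigroup S) (idem_star (Idempotent ee)) gs b3).
    split; apply/boset_mulP; split=> //; rewrite /=.
    by rewrite -[rstar e * e * g]rmulA -eg [g * _]rmulA -ge rmulA.
Qed.

Definition forget_obj : rsbs := Rsbs (RsbsOn forget_laws).

(* The usual description of the sandwich set in a regular semigroup. *)
Lemma sandwichE (e f g : forget_obj) :
  sandwich (@bmul forget_obj) e f g <->
  [/\ sval g * sval e = sval g, sval f * sval g = sval g
    & sval e * sval g * sval f = sval e * sval f].
Proof.
have inME h : in_M m e f h <->
    sval h * sval e = sval h /\ sval f * sval h = sval h.
  split=> [[/boset_mulP[_ /= he] /boset_mulP[_ /= fh]]|[he fh]].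
    by rewrite -he -fh.
  by split; apply: boset_mulI => //; rewrite /basic_pair /=; tauto.
split.
- case=> /inME[ge fg] gmax.
  pose x := rstar (sval e * sval f); pose h := sval f * x * sval e.
  have xx : x * (sval e * sval f) * x = x.
    by have := rmulR x; rewrite /x rstarK.
  have hh : h * h = h.
    by rewrite /h -[in RHS]xx !rmulA.
  have /gmax : in_M m e f (Idempotent (S := rss_semigroup S) hh).
    have ee : sval e * sval e = sval e := svalP e.
    have ff : sval f * sval f = sval f := svalP f.
    by apply/inME; rewrite /= /h -rmulA ee !rmulA ff.
  case=> eh [eg [hf [gf [[/boset_mulP[_ /= ehE] /boset_mulP[_ /= egE]
    /boset_mulP[_ /= hfE] /boset_mulP[_ /= gfE]]]]]].
  case=> /boset_mulP[_ /= _] /boset_mulP[_ /=].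
  rewrite hfE gfE => hfg.
  have ehf : sval e * h * sval f = sval e * sval f.
    by rewrite -[RHS]rmulR /h !rmulA.
  split=> //; rewrite -[RHS]ehf -[RHS]rmulA hfg rmulA [sval e * _]rmulA ehf.
  by rewrite rmulA -[sval e * sval f * _]rmulA fg.
- case=> ge fg egf; split; first exact/inME.
  move=> h /inME[he fh].
  have b1 : basic_pair (sval e) (sval h) by right; right.
  have b2 : basic_pair (sval e) (sval g) by right; right.
  have b3 : basic_pair (sval h) (sval f) by right; left.
  have b4 : basic_pair (sval g) (sval f) by right; left.
  exists (idempotent_mul b1), (idempotent_mul b2).
  exists (idempotent_mul b3), (idempotent_mul b4).
  split; first by split; apply/boset_mulP.
  have egh : sval e * sval g * (sval e * sval h) = sval e * sval h.
    rewrite rmulA -[sval e * sval g * _]rmulA ge -{1}fh rmulA egf.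
    by rewrite -rmulA fh.
  have hgf : sval h * sval f * (sval g * sval f) = sval h * sval f.
    rewrite rmulA -[_ * _ * sval g]rmulA fg -{1}he -!rmulA [sval e * _]rmulA.
    by rewrite egf rmulA he.
  by split; apply: boset_mulI => //=; left; [right|left].
Qed.
End ForgetObject.

Section ForgetMorphism.
Variables (S S' : rss) (phi : rss_hom S S').

Lemma forget_funP (e : forget_obj S) :
  rmul (phi (sval e)) (phi (sval e)) = phi (sval e).
Proof. by rewrite -rss_funM; congr (phi _); exact: (svalP e). Qed.

Definition forget_fun (e : forget_obj S) : forget_obj S' :=
  Idempotent (S := rss_semigroup S') (forget_funP e).

Lemma forget_funM (e f g : forget_obj S) :
  bmul e f = Some g ->
  bmul (forget_fun e) (forget_fun f) = Some (forget_fun g).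
Proof.
case/boset_mulP=> ef gE; apply: boset_mulI; rewrite /= ?gE /= ?rss_funM //.
by move: ef; rewrite /basic_pair /= -!rss_funM; case=> [][->|->]; tauto.
Qed.

Lemma forget_funW (e f g : forget_obj S) :
  sandwich (@bmul (forget_obj S)) e f g ->
  sandwich (@bmul (forget_obj S')) (forget_fun e) (forget_fun f) (forget_fun g).
Proof.
case/sandwichE=> ge fg egf; apply/sandwichE.
by rewrite /= -!rss_funM ge fg egf.
Qed.

Lemma forget_funS (e : forget_obj S) :
  forget_fun (bstar e) = bstar (forget_fun e).
Proof. by apply: idempotent_inj; exact: rss_funS. Qed.

Definition forget_hom : rsbs_hom (forget_obj S) (forget_obj S') :=
  RsbsHom forget_funM forget_funW forget_funS.
End ForgetMorphism.

Definition forget : functor RSS RSBS.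
Proof.
by refine (@Functor RSS RSBS forget_obj forget_hom _ _) => *;
  apply: rsbs_hom_ext => e; apply: idempotent_inj.
Defined.

(** * Projection algebras *)

(* [th q p] stands for the value q theta_p, the operation theta_p being written
   to the right of its argument; so q theta_p theta_r is [th (th q p) r]. *)
Record projalg_laws (T : Type) (th : T -> T -> T) : Prop := ProjalgLaws {
  pa_law1 : forall p, th p p = p;
  pa_law2 : forall p x, th (th x p) p = th x p;
  pa_law3 : forall p q, th (th p q) p = th q p;
  pa_law4 : forall p q x, th (th (th x p) q) p = th x (th q p);
  pa_law5 : forall p q x, th (th (th (th x p) q) p) q = th (th x p) q }.

Record projalg := Projalg {
  pa_sort :> Type;
  theta : pa_sort -> pa_sort -> pa_sort;
  pa_laws : projalg_laws theta }.

Notation "q |> p" := (theta q p) (at level 40, left associativity).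

Record projalg_hom (P P' : projalg) := ProjalgHom {
  pa_fun :> P -> P';
  pa_funM : forall p q, pa_fun (p |> q) = pa_fun p |> pa_fun q }.

Lemma projalg_hom_ext (P P' : projalg) (f g : projalg_hom P P') :
  f =1 g -> f = g.
Proof.
case: f g => [f fM] [g gM] /= /funext fg; subst g.
by rewrite (Prop_irrelevance fM gM).
Qed.

Definition projalg_id (P : projalg) : projalg_hom P P :=
  @ProjalgHom P P id (fun _ _ => erefl).

Section ProjalgComp.
Variables (A B C : projalg) (f : projalg_hom A B) (g : projalg_hom B C).
Let h a := g (f a).
Lemma projalg_compM a b : h (a |> b) = h a |> h b.
Proof. by rewrite /h !pa_funM. Qed.
Definition projalg_comp : projalg_hom A C := ProjalgHom projalg_compM.
End ProjalgComp.

Definition PA : category.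
Proof.
by refine (@Category projalg projalg_hom projalg_id projalg_comp _ _ _) => *;
  exact: projalg_hom_ext.
Defined.

Section ProjalgTheory.
Variable P : projalg.
Implicit Types p q r x e f : P.

Lemma th1 p : p |> p = p. Proof. exact: (pa_law1 (pa_laws P)). Qed.
Lemma th2 p x : x |> p |> p = x |> p.
Proof. exact: (pa_law2 (pa_laws P)). Qed.
Lemma th3 p q : p |> q |> p = q |> p.
Proof. exact: (pa_law3 (pa_laws P)). Qed.
Lemma th4 p q x : x |> p |> q |> p = x |> (q |> p).
Proof. exact: (pa_law4 (pa_laws P)). Qed.
Lemma th5 p q x : x |> p |> q |> p |> q = x |> p |> q.
Proof. exact: (pa_law5 (pa_laws P)). Qed.

Definition leF p q : Prop := p = q |> p.

(* MathComp's [path] needs a boolean relation, hence the reflected form. *)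
Definition eqF : rel P := fun p q => `[< leF p q /\ leF q p >].

Lemma eqFP p q : reflect (leF p q /\ leF q p) (eqF p q).
Proof. exact: asboolP. Qed.

Lemma eqF_sym : symmetric eqF.
Proof. by move=> p q; apply/eqFP/eqFP => -[]. Qed.

Lemma eqF_theta p q : eqF (p |> q) (q |> p).
Proof. by apply/eqFP; rewrite /leF -!th4 !th3. Qed.

(* One step of the restriction of a path. *)
Lemma eqF_step p q x : eqF p q -> x |> p = x -> eqF x (x |> q).
Proof.
move=> /eqFP[pq _] xp; apply/eqFP; rewrite /leF.
have qx : q |> x = x by rewrite -{1}xp -th4 -pq th3.
by rewrite -th4 !th3 qx.
Qed.

(** ** The path category *)

(* [PPath p s _] is the P-path listed by [p :: s]. *)
Record ppath := PPath { src : P; rest : seq P; _ : path eqF src rest }.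
Definition tgt (a : ppath) : P := last (src a) (rest a).
Definition verts (a : ppath) : seq P := src a :: rest a.

Lemma ppathP (a : ppath) : path eqF (src a) (rest a). Proof. by case: a. Qed.

Lemma ppath_ext (a b : ppath) : verts a = verts b -> a = b.
Proof.
case: a b => [p s ps] [q t qt] [] pq st; subst q t.
by rewrite (Prop_irrelevance ps qt).
Qed.

Lemma pcompP (a b : ppath) :
  tgt a = src b -> path eqF (src a) (rest a ++ rest b).
Proof. by move=> ab; rewrite cat_path ppathP -/(tgt a) ab ppathP. Qed.

Definition pcomp (a b : ppath) (ab : tgt a = src b) : ppath :=
  PPath (pcompP ab).

Definition linked p e f : Prop := f = e |> p |> f /\ e = f |> p |> e.

Inductive pgen : seq P -> seq P -> Prop :=
| PGen1 p : pgen [:: p; p] [:: p]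
| PGen2 p q : eqF p q -> pgen [:: p; q; p] [:: p]
| PGen3 p e f : linked p e f -> pgen [:: e; e |> p; f] [:: e; f |> p; f].

Inductive pcong : ppath -> ppath -> Prop :=
| pcong_gen a b : pgen (verts a) (verts b) -> pcong a b
| pcong_refl a : pcong a a
| pcong_sym a b : pcong a b -> pcong b a
| pcong_trans a b c : pcong a b -> pcong b c -> pcong a c
| pcong_comp a a' b b' (ab : tgt a = src b) (ab' : tgt a' = src b') :
    pcong a a' -> pcong b b' -> pcong (pcomp ab) (pcomp ab').

(** ** Operations on paths *)

Lemma prevP (a : ppath) : path eqF (tgt a) (rev (belast (src a) (rest a))).
Proof.
by rewrite rev_path (eq_path (e' := eqF)) ?ppathP // => p q; rewrite eqF_sym.
Qed.

Definition prev (a : ppath) : ppath := PPath (prevP a).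

(* [prestr x (q_1, ..., q_l)] is
   (x theta_{q_1}, ..., x theta_{q_1} ... theta_{q_l}). *)
Lemma prestrP x (b : ppath) :
  path eqF (x |> src b) (scanl (@theta P) (x |> src b) (rest b)).
Proof.
case: b => q s /=; move: (x |> q) (th2 q x) => {}x.
elim: s q x => //= r s IHs q x xq /andP[qr rs].
by rewrite (eqF_step qr xq) (IHs r) ?th2.
Qed.

Definition prestr x (b : ppath) : ppath := PPath (prestrP x b).

Lemma pjoinP (a b : ppath) :
  eqF (tgt a) (src b) -> path eqF (src a) (rest a ++ verts b).
Proof. by move=> ab; rewrite cat_path ppathP /= -/(tgt a) ab ppathP. Qed.

Definition pjoin (a b : ppath) (ab : eqF (tgt a) (src b)) : ppath :=
  PPath (pjoinP ab).

Lemma tgt_prev (a : ppath) : tgt (prev a) = src a.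
Proof.
have h p s : last (last p s) (rev (belast p s)) = p :> P.
  by case: (lastP s) => // s' x; rewrite belast_rcons rev_cons last_rcons.
exact: h.
Qed.

(* The path (p_1', ..., p_k', q_1', ..., q_l') of the definition of the product
   in PG(P). *)
Lemma pprodP (a b : ppath) :
  eqF (tgt (prev (prestr (src b |> tgt a) (prev a))))
    (src (prestr (tgt a |> src b) b)).
Proof. by rewrite tgt_prev /= !th2 eqF_theta. Qed.

Definition pprod (a b : ppath) : ppath := pjoin (pprodP a b).

(** ** The set PG(P) and its operations *)

Definition pclass (a : ppath) : set ppath := [set b | pcong a b].

Definition PG : Type := {c : set ppath | exists a, c = pclass a}.

Definition PG_class (a : ppath) : PG :=
  exist _ (pclass a) (ex_intro _ a erefl).

Definition PG_repr (c : PG) : ppath := sval (cid (svalP c)).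

Definition PG_mul (c d : PG) : PG := PG_class (pprod (PG_repr c) (PG_repr d)).
Definition PG_star (c : PG) : PG := PG_class (prev (PG_repr c)).

Lemma PG_reprK (c : PG) : PG_class (PG_repr c) = c.
Proof.
rewrite /PG_repr; case: c => c cP /=; case: cid => a /= ca; subst c.
by congr exist; exact: Prop_irrelevance.
Qed.

Lemma PG_classP (a b : ppath) : PG_class a = PG_class b <-> pcong a b.
Proof.
split=> [/(congr1 sval) /= ab|ab].
  have : pclass b b by exact: pcong_refl.
  by rewrite -ab.
have e : pclass a = pclass b.
  apply/seteqP; split=> c; rewrite /pclass /= => ac.
    exact: pcong_trans (pcong_sym ab) ac.
  exact: pcong_trans ab ac.
rewrite /PG_class; move: (ex_intro _ a _) (ex_intro _ b _); rewrite e => u v.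
by congr exist; exact: Prop_irrelevance.
Qed.

Lemma PG_repr_cong (a : ppath) : pcong (PG_repr (PG_class a)) a.
Proof. by apply/PG_classP; rewrite PG_reprK. Qed.

Lemma verts_prev (a : ppath) : verts (prev a) = rev (verts a).
Proof. by rewrite /verts /= /tgt [in RHS]lastI rev_rcons. Qed.

Lemma pgen_rev s t : pgen s t -> pgen (rev s) (rev t) \/ pgen (rev t) (rev s).
Proof.
case=> [p|p q pq|p e f [lf le]]; [left|left|right]; first exact: PGen1.
  exact: PGen2.
exact: PGen3.
Qed.

Lemma prev_cong (a b : ppath) : pcong a b -> pcong (prev a) (prev b).
Proof.
elim=> [{}a {}b /pgen_rev|{}a|{}a {}b _|{}a {}b c _ ab _ bc
       |{}a a' {}b b' ab ab' _ IHa _ IHb].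
- rewrite -!verts_prev => -[]; first exact: pcong_gen.
  by move=> ?; apply: pcong_sym; apply: pcong_gen.
- exact: pcong_refl.
- exact: pcong_sym.
- exact: pcong_trans ab bc.
- have H c d (cd : tgt c = src d) (dc : tgt (prev d) = src (prev c)) :
      prev (pcomp cd) = pcomp dc.
    apply: ppath_ext; rewrite verts_prev.
    have -> : verts (pcomp dc) = verts (prev d) ++ behead (verts (prev c)).
      by [].
    rewrite !verts_prev /verts /= [in rev (src c :: rest c)]lastI rev_rcons /=.
    rewrite -/(tgt c) -cat_cons -[src c :: rest c]/(verts c).
    rewrite /verts [src c :: rest c]lastI -/(tgt c) cd cat_rcons rev_cat.
    by [].
  have ba : tgt (prev b) = src (prev a) by rewrite tgt_prev /= ab.
  have ba' : tgt (prev b') = src (prev a') by rewrite tgt_prev /= ab'.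
  by rewrite (H _ _ _ ba) (H _ _ _ ba'); apply: pcong_comp.
Qed.

Lemma verts_pprod (a b : ppath) :
  verts (pprod a b) =
  rev (verts (prestr (src b |> tgt a) (prev a)))
    ++ verts (prestr (tgt a |> src b) b).
Proof. by rewrite -verts_prev. Qed.

End ProjalgTheory.

(* Well-definedness of PG(P), and the fact that it is a regular *-semigroup.
   These are not proved here but form part of the theorem; [PG_mul_cong] says
   that the product of classes does not depend on the paths representing
   them. *)
Record PG_well_defined : Prop := PGWellDefined {
  PG_mul_cong : forall (P : projalg) (a a' b b' : ppath P),
    pcong a a' -> pcong b b' -> pcong (pprod a b) (pprod a' b');
  PG_laws : forall P : projalg, rss_laws (@PG_mul P) (@PG_star P) }.

Section PGMorphism.
Variables (P P' : projalg) (phi : projalg_hom P P').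

Lemma eqF_map (p q : P) : eqF p q -> eqF (phi p) (phi q).
Proof. by move=> /eqFP[pq qp]; apply/eqFP; rewrite /leF -!pa_funM -pq -qp. Qed.

Lemma pmapP (a : ppath P) : path (@eqF P') (phi (src a)) (map phi (rest a)).
Proof.
case: a => p s /=; elim: s p => //= q s IHs p /andP[pq qs].
by rewrite eqF_map ?IHs.
Qed.

Definition pmap (a : ppath P) : ppath P' := PPath (pmapP a).

Lemma verts_pmap a : verts (pmap a) = map phi (verts a).
Proof. by []. Qed.

Lemma tgt_pmap a : tgt (pmap a) = phi (tgt a).
Proof. by rewrite /tgt /= last_map. Qed.

Lemma pmap_cong a b : pcong a b -> pcong (pmap a) (pmap b).
Proof.
elim=> [{}a {}b ab|{}a|{}a {}b _|{}a {}b c _ ab _ bc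
       |{}a a' {}b b' ab ab' _ IHa _ IHb].
- apply: pcong_gen; rewrite !verts_pmap.
  case: ab => [p|p q /eqF_map pq|p e f [lf le]] /=; rewrite ?pa_funM.
  + exact: PGen1.
  + exact: PGen2.
  + by apply: PGen3; rewrite /linked -!pa_funM -lf -le.
- exact: pcong_refl.
- exact: pcong_sym.
- exact: pcong_trans ab bc.
- have h : tgt (pmap a) = src (pmap b) by rewrite tgt_pmap ab.
  have h' : tgt (pmap a') = src (pmap b') by rewrite tgt_pmap ab'.
  have -> : pmap (pcomp ab) = pcomp h.
    by apply: ppath_ext; rewrite /verts /= map_cat.
  have -> : pmap (pcomp ab') = pcomp h'.
    by apply: ppath_ext; rewrite /verts /= map_cat.
  exact: pcong_comp.
Qed.

Lemma pmap_prev a : pmap (prev a) = prev (pmap a).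
Proof.
by apply: ppath_ext; rewrite verts_prev !verts_pmap verts_prev map_rev.
Qed.

Lemma verts_pmap_prestr x a :
  map phi (verts (prestr x a)) = verts (prestr (phi x) (pmap a)).
Proof.
rewrite /verts /= pa_funM; congr cons.
rewrite -pa_funM; move: (x |> src a) => {}x.
by elim: (rest a) x => //= r s IHs x; rewrite IHs pa_funM.
Qed.

Lemma pmap_pprod a b : pmap (pprod a b) = pprod (pmap a) (pmap b).
Proof.
apply: ppath_ext; rewrite verts_pmap !verts_pprod map_cat map_rev.
by rewrite !verts_pmap_prestr !pa_funM pmap_prev !tgt_pmap.
Qed.

Definition PG_map (c : PG P) : PG P' := PG_class (pmap (PG_repr c)).

Lemma PG_mapE a : PG_map (PG_class a) = PG_class (pmap a).
Proof. by apply/PG_classP; apply: pmap_cong; exact: PG_repr_cong. Qed.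

Lemma PG_mapS c : PG_map (PG_star c) = PG_star (PG_map c).
Proof.
rewrite /PG_star PG_mapE pmap_prev; apply/PG_classP/prev_cong/pcong_sym.
exact: PG_repr_cong.
Qed.

Lemma PG_mapM (w : PG_well_defined) c d :
  PG_map (PG_mul c d) = PG_mul (PG_map c) (PG_map d).
Proof.
rewrite /PG_mul PG_mapE pmap_pprod; apply/PG_classP.
by apply: PG_mul_cong => //; apply: pcong_sym; exact: PG_repr_cong.
Qed.

End PGMorphism.

Section PGFunctor.
Variable w : PG_well_defined.

Definition PG_obj (P : projalg) : rss := Rss (RssOn (PG_laws w P)).

Definition PG_hom (P P' : projalg) (phi : projalg_hom P P') :
    rss_hom (PG_obj P) (PG_obj P') :=
  @RssHom (PG_obj P) (PG_obj P') (PG_map phi) (PG_mapM phi w) (PG_mapS phi).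

Lemma PG_hom_id (P : projalg) : PG_hom (projalg_id P) = rss_id (PG_obj P).
Proof.
apply: rss_hom_ext => c /=; rewrite -[RHS]PG_reprK; congr PG_class.
by apply: ppath_ext; rewrite verts_pmap /= map_id.
Qed.

Lemma PG_hom_comp (A B C : projalg) (f : projalg_hom A B)
    (g : projalg_hom B C) :
  PG_hom (projalg_comp f g) = rss_comp (PG_hom f) (PG_hom g).
Proof.
apply: rss_hom_ext => c /=; rewrite [X in PG_map g X]/PG_map PG_mapE.
by congr PG_class; apply: ppath_ext; rewrite !verts_pmap -map_comp.
Qed.

Definition PG_functor : functor PA RSS :=
  @Functor PA RSS PG_obj PG_hom PG_hom_id PG_hom_comp.

End PGFunctor.

(** * The projection algebra of a regular *-boset *)

Section Projections.
Variable E : rsbs.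
Implicit Types p q e : E.

Definition proj : Type := {p : E | p = bstar p}.

Lemma proj_inj (p q : proj) : sval p = sval q -> p = q.
Proof.
case: p q => [p pp] [q qq] /= pq; subst q.
by rewrite (Prop_irrelevance pp qq).
Qed.

(* The specification of e(p,q). *)
Definition proj_e p q e : Prop :=
  [/\ sandwich (@bmul E) p q e,
      (exists r, bmul p e = Some r /\ r = bstar r)
    & (exists r, bmul e q = Some r /\ r = bstar r)].

Definition unique_proj_e : Prop :=
  forall p q, p = bstar p -> q = bstar q -> exists! e, proj_e p q e.

Hypothesis he : unique_proj_e.

Lemma proj_theta_subproof (q p : proj) :
  exists r : proj, exists e,
    proj_e (sval p) (sval q) e /\ bmul (sval p) e = Some (sval r).
Proof.
have [e [pqe _]] := he (svalP p) (svalP q).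
by case: (pqe) => _ [r [per rr]] _; exists (exist _ r rr), e.
Qed.

(* q theta_p = p e(p,q) *)
Definition proj_theta (q p : proj) : proj :=
  sval (cid (proj_theta_subproof q p)).

Lemma proj_thetaP (q p r : proj) :
  proj_theta q p = r <->
  exists e, proj_e (sval p) (sval q) e /\ bmul (sval p) e = Some (sval r).
Proof.
rewrite /proj_theta; case: cid => r' /= [e [pqe per']]; split=> [<-|].
  by exists e.
case=> e' [pqe' per]; have [x [_ ux]] := he (svalP p) (svalP q).
apply: proj_inj; move: per'.
by rewrite -(ux _ pqe) (ux _ pqe') per; case.
Qed.

End Projections.

(* Existence and uniqueness of the e(p,q), and the fact that P(E) is a projection
   algebra.  Again these are part of the theorem. *)
Record P_well_defined : Prop := PWellDefined {
  P_unique : forall E : rsbs, unique_proj_e E;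
  P_laws : forall E : rsbs, projalg_laws (proj_theta (@P_unique E)) }.

Section PFunctor.
Variable w : P_well_defined.

Definition P_obj (E : rsbs) : projalg := Projalg (P_laws w E).

Section Morphism.
Variables (E E' : rsbs) (phi : rsbs_hom E E').

Lemma P_funP (p : P_obj E) : phi (sval p) = bstar (phi (sval p)).
Proof. by rewrite -rsbs_funS; congr (phi _); exact: (svalP p). Qed.

Definition P_fun (p : P_obj E) : P_obj E' := exist _ (phi (sval p)) (P_funP p).

Lemma P_funM (q p : P_obj E) : P_fun (q |> p) = P_fun q |> P_fun p.
Proof.
apply/esym/proj_thetaP.
have /proj_thetaP[e [[pqe [r [per rr]] [t [eqt tt]]] pe]] := erefl (q |> p).
exists (phi e); split; last exact: rsbs_funM.
split; first exact: rsbs_funW.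
  by exists (phi r); split; [exact: rsbs_funM | rewrite -rsbs_funS -rr].
by exists (phi t); split; [exact: rsbs_funM | rewrite -rsbs_funS -tt].
Qed.

Definition P_hom : projalg_hom (P_obj E) (P_obj E') := ProjalgHom P_funM.
End Morphism.

Definition P_functor : functor RSBS PA.
Proof.
by refine (@Functor RSBS PA P_obj P_hom _ _) => *;
  apply: projalg_hom_ext => p; apply: proj_inj.
Defined.

End PFunctor.

(** * Structures on subsets of a fixed type *)

(* Here the objects are structures on subsets of [U], so that equality of
   objects is set-theoretic: same underlying set, same operations.  As PG(P)
   consists of classes of finite sequences over P, an injection [seq U -> U]
   ensures that U contains copies of the PG(P) for the P contained in U. *)
Definition RSS_in (U : Type) : category :=
  @induced_category RSS {A : set U & rss_on A}
    (fun X => Rss (projT2 X)).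

Definition RSBS_in (U : Type) : category :=
  @induced_category RSBS {A : set U & rsbs_on A}
    (fun X => Rsbs (projT2 X)).

(* Main.v *)
Require Import Defs.
From mathcomp Require Import all_boot.
From mathcomp Require Import boolp classical_sets.
Import Defs.

Set Implicit Arguments.
Unset Strict Implicit.
Unset Printing Implicit Defensive.

(** The left adjoint is fully faithful because its unit is an isomorphism, and
    the adjunction holds because PG(P) carries the universal representation of
    the projection algebra P.

    Call f : P -> S, with S a semigroup, a representation if each f p is
    idempotent, each f p * f q is idempotent, and f p * f q * f p = f (q |> p).
    The product of the values of f along a path depends only on the class of
    the path, and it turns the product of PG(P) into that of S
    ([path_prod_cong], [path_prod_pprod]).  One representation is faithful: P
    acts on PG(P), enlarged by a point, by left multiplication
    ([PG_lact_repr], [PG_action_inj]).  So PG(P) is isomorphic to a semigroup of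
    transformations, which gives both the independence of representatives and
    associativity; the real work is to check the three relations for the action
    on paths, the hard one being [lact_conj].  It follows that p |-> [[p]] is
    itself a representation.

    Let a regular *-boset E be the boset of a regular semigroup S. Every
    R-class and every L-class of S contains exactly one projection, and q
    theta_p is the projection in the R-class of pq ([theta_R], [theta_uniq]);
    the axioms of a projection algebra become statements that certain products
    of projections are R-related. The semigroup S carries no involution, so
    products of two projections need not be idempotent in S; the last axiom of
    regular *-bosets makes up for this through [square_below]: on projections
    below the one in the L-class of an idempotent e, left multiplication by e
    and by the projection in the R-class of e have R-related results.

    Each e in E lies in the R-class of one projection s and in the L-class of
    one projection t.  The pair (s, t) determines e, every F-related pair
    occurs, and (s, t) obeys formulas in terms of theta under multiplication
    ([mul_fixl_dom], [dom_mul]).  The idempotents of PG(P) are exactly the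
    classes [[s, t]] with s F t ([PG_idem_edge]), and they obey the same
    formulas, so that e |-> [[s, t]] is an isomorphism from E to the boset of
    PG(P(E)) ([eta_funM], [eta_iso]).  A morphism from E to the boset of a
    regular *-semigroup T restricts to a representation of P(E) in T
    ([ext_gen_repr]), hence extends along this isomorphism to PG(P(E)),
    uniquely because PG(P(E)) is generated by projections ([ext_homE],
    [eta_ext]).

    For structures on subsets of U, PG(P(E)) is copied into U so that the
    idempotent corresponding to e becomes the code of the sequence [:: e], and
    all other elements become codes of longer sequences.  The set and the
    operations of E can be read off from this copy, so the functor is injective
    on objects ([PG_in_inj]). *)

(** * Projection algebras *)

Section ProjectionAlgebra.
Variable P : projalg.
Implicit Types p q r x y z : P.

Lemma theta_above p q : q |> p = q -> p |> q = q.
Proof. by move=> qp; rewrite -{1}qp -th4 th1 th3. Qed.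

Lemma theta_swap x p q : x |> (q |> p) |> (p |> q) = x |> p |> q.
Proof. by rewrite -!th4 !th5. Qed.

(** Read [x |> y = x] as x <= y: restricting to the image of [y] at the next
    vertex of a path changes nothing, and the inequality is inherited.  By
    iteration, restricting a path in two stages is restricting it once. *)
Lemma theta_step x y r : x |> y = x ->
  x |> (y |> r) = x |> r /\ x |> r |> (y |> r) = x |> r.
Proof. by move=> xy; rewrite -!th4 th2 -xy th5. Qed.

Lemma scanl_theta x y (s : seq P) : x |> y = x ->
  scanl (@theta P) x (scanl (@theta P) y s) = scanl (@theta P) x s.
Proof.
elim: s x y => //= r s IHs x y /(@theta_step x y r)[e1 e2].
by rewrite e1 IHs.
Qed.

Lemma scanl_theta_id x (s : seq P) :
  path (@eqF P) x s -> scanl (@theta P) x s = s.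
Proof.
elim: s x => //= r s IHs x /andP[/eqFP[_ rx] rs].
by rewrite -rx IHs.
Qed.

(** * Representations of a projection algebra *)

(** These relations define PG(P) as an abstract semigroup with generators P;
    they are symmetric under reversal of words. *)
Record representation (S : semigroup) (f : P -> S) : Prop := Representation {
  repr_idem : forall p, sg_mul (f p) (f p) = f p;
  repr_sq : forall p q,
    sg_mul (sg_mul (f p) (f q)) (sg_mul (f p) (f q)) = sg_mul (f p) (f q);
  repr_conj : forall p q, sg_mul (sg_mul (f p) (f q)) (f p) = f (q |> p) }.

Section Product.
Variables (S : semigroup) (f : P -> S).

Fixpoint seq_prod p (s : seq P) : S :=
  if s is q :: s' then sg_mul (f p) (seq_prod q s') else f p.

Definition path_prod (a : ppath P) : S := seq_prod (src a) (rest a).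

Lemma seq_prod_cat p s q t :
  seq_prod p (s ++ q :: t) = sg_mul (seq_prod p s) (seq_prod q t).
Proof. by elim: s p => //= r s IHs p; rewrite IHs sg_mulA. Qed.

End Product.

(** Representations in the opposite semigroup give the statements about paths
    restricted at their end from those about paths restricted at their start. *)
Definition op_semigroup (S : semigroup) : semigroup :=
  @Semigroup S (fun a b => sg_mul b a) (fun a b c => esym (sg_mulA c b a)).

Lemma seq_prod_rev (S : semigroup) (f : P -> S) p s q t :
  rev (p :: s) = q :: t ->
  seq_prod (S := op_semigroup S) f q t = seq_prod f p s.
Proof.
elim: s p q t => [|r s IHs] p q t; first by case=> <- <-.
rewrite rev_cons; case E: (rev (r :: s)) => [|q' t'].
  by have := size_rev (r :: s); rewrite E.
by case=> <- <-; rewrite -cats1 seq_prod_cat /= (IHs _ _ _ E).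
Qed.

Lemma prevK (a : ppath P) : prev (prev a) = a.
Proof. by apply: ppath_ext; rewrite !verts_prev revK. Qed.

Lemma path_prod_prev (S : semigroup) (f : P -> S) (a : ppath P) :
  path_prod (S := op_semigroup S) f (prev a) = path_prod f a.
Proof. by apply: seq_prod_rev; rewrite -[LHS]verts_prev. Qed.

Section RepresentationTheory.
Variables (S : semigroup) (f : P -> S).
Hypothesis fR : representation f.
Local Notation "a * b" := (sg_mul a b).

Let fI := repr_idem fR.
Let fQ := repr_sq fR.
Let fC := repr_conj fR.

Lemma repr_op : representation (S := op_semigroup S) f.
Proof. by split=> [p|p q|p q] /=; rewrite ?fI ?fQ // sg_mulA fC. Qed.

Lemma repr_mul p q : f p * f q = f (q |> p) * f (p |> q).
Proof.
have -> : f (q |> p) * f (p |> q) = f p * f q * (f p * f q) * (f p * f q).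
  by rewrite -!fC !sg_mulA.
by rewrite !fQ.
Qed.

Lemma repr_below p q : q |> p = q -> f q * f p = f q /\ f p * f q = f q.
Proof.
by move=> <-; rewrite -fC; split; [rewrite -sg_mulA fI|rewrite !sg_mulA fI].
Qed.

Lemma seq_prod_first p s : f p * seq_prod f p s = seq_prod f p s.
Proof. by case: s => [|q s] /=; rewrite ?sg_mulA fI. Qed.

Lemma seq_prod_last p s : seq_prod f p s * f (last p s) = seq_prod f p s.
Proof. by elim: s p => [|q s IHs] p /=; rewrite ?fI // -sg_mulA IHs. Qed.

Lemma path_prod_comp (a b : ppath P) (ab : tgt a = src b) :
  path_prod f (pcomp ab) = path_prod f a * path_prod f b.
Proof.
rewrite /path_prod /=; case: (rest b) => [|q t] /=.
  by rewrite cats0 -ab seq_prod_last.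
by rewrite seq_prod_cat sg_mulA -ab seq_prod_last.
Qed.

(** For the third kind of generating pair both sides equal f e * f p * f g,
    whatever the linked elements are. *)
Lemma path_prod_cong (a b : ppath P) :
  pcong a b -> path_prod f a = path_prod f b.
Proof.
elim=> [{}a {}b ab|//|//|{}a {}b c _ -> _ -> //|].
- case: a b ab => [p s ps] [q t qt]; rewrite /path_prod /verts /=.
  move es: (p :: s) => s'; move et: (q :: t) => t' st.
  case: st es et => [r|r r' /eqFP[rr' _]|r e g _] [-> ->] [-> ->] /=.
  + exact: fI.
  + by rewrite sg_mulA fC -rr'.
  + rewrite -!fC; transitivity (f e * f r * f g).
      by rewrite -[in RHS](fQ e r) !sg_mulA.
    by rewrite -(sg_mulA (f e)) -[in LHS](fQ r g) !sg_mulA.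
- move=> {}a a' {}b b' ab ab' _ IHa _ IHb.
  by rewrite !path_prod_comp IHa IHb.
Qed.

(** Multiplying by [f x] for [x] below the first vertex restricts the path:
    [x] passes each vertex and becomes its image there. *)
Lemma seq_prod_restr x p (s : seq P) : path (@eqF P) p s -> x |> p = x ->
  f x * seq_prod f p s = seq_prod f x (scanl (@theta P) x s).
Proof.
elim: s p x => [|q s IHs] p x /=; first by move=> _ /repr_below[].
case/andP=> pq qs xp.
have e : f x * f q = f x * f (x |> q).
  have qx : q |> x = x by move/eqFP: pq => [pE _]; rewrite -xp -th4 -pE th3.
  by rewrite repr_mul qx.
have [xp' _] := repr_below xp; rewrite sg_mulA xp'.
rewrite -(seq_prod_first q) sg_mulA e -sg_mulA.
by rewrite (IHs q) ?th2.
Qed.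

Lemma path_prod_restr x (b : ppath P) : x |> src b = x ->
  f x * path_prod f b = path_prod f (prestr x b).
Proof.
case: b => p s ps; rewrite /path_prod /= => xp.
by rewrite seq_prod_restr ?xp.
Qed.

Lemma path_prodS (a : ppath P) :
  path_prod f a * path_prod f (prev a) = f (src a).
Proof.
case: a => p s; elim: s p => [|q s IHs] p ps; first exact: fI.
have /= /andP[/eqFP[pq _] qs] := ps.
have -> : path_prod f (prev (PPath ps)) = path_prod f (prev (PPath qs)) * f p.
  by rewrite -[LHS]path_prod_prev -(path_prod_prev f (prev (PPath qs))) !prevK.
have -> : path_prod f (PPath ps) = f p * path_prod f (PPath qs) by [].
move: (path_prod f (prev (PPath qs))) (path_prod f (PPath qs)) (IHs q qs).
move=> W' W WW'; transitivity (f p * (W * W') * f p); first by rewrite !sg_mulA.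
by rewrite WW' fC -pq.
Qed.

End RepresentationTheory.

(** By [repr_mul] the two factors meet in the vertices q theta_p and p theta_q;
    each of these restricts the path on its side. *)
Lemma path_prod_pprod (S : semigroup) (f : P -> S) (a b : ppath P) :
  representation f ->
  path_prod f (pprod a b) = sg_mul (path_prod f a) (path_prod f b).
Proof.
move=> fR; set p := tgt a; set q := src b.
set A := prestr (q |> p) (prev a); set B := prestr (p |> q) b.
have -> : path_prod f (pprod a b) =
    sg_mul (path_prod f (prev A)) (path_prod f B).
  exact: seq_prod_cat.
have <- : sg_mul (path_prod f a) (f (q |> p)) = path_prod f (prev A).
  rewrite -(path_prod_prev f (prev A)) prevK.
  by rewrite -(path_prod_restr (repr_op fR)) /= ?th2 // path_prod_prev.
have <- : sg_mul (f (p |> q)) (path_prod f b) = path_prod f B.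
  by rewrite path_prod_restr ?th2.
rewrite -sg_mulA (sg_mulA (f _) (f _)) -repr_mul // !sg_mulA.
have -> : sg_mul (path_prod f a) (f p) = path_prod f a by exact: seq_prod_last.
by rewrite -sg_mulA [sg_mul (f q) _](seq_prod_first fR).
Qed.

(** * The left regular representation of PG(P) *)

Lemma pcong_ends (a b : ppath P) : pcong a b -> src a = src b /\ tgt a = tgt b.
Proof.
elim=> [{}a {}b|//|{}a {}b _ [-> ->] //|{}a {}b c _ [-> ->] _ [-> ->] //|].
- case: a b => [p s ps] [q t qt]; rewrite /verts /tgt /=.
  move es: (p :: s) => s'; move et: (q :: t) => t' st.
  by case: st es et => [r|r r' _|r e g _] [-> ->] [-> ->].
- move=> {}a a' {}b b' ab ab' _ [sa ta] _ [sb tb]; split=> //.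
  by rewrite /tgt /= !last_cat -!/(tgt _) ab ab' -/(tgt b) -/(tgt b').
Qed.

Lemma path_cat_last (a : ppath P) p s u : rest a = s ++ u -> src a = p ->
  path (@eqF P) (last p s) u.
Proof. by move=> e <-; have := ppathP a; rewrite e cat_path => /andP[]. Qed.

Lemma verts_path (a : ppath P) p s : verts a = p :: s -> path (@eqF P) p s.
Proof. by case: a => q t qt [<- <-]. Qed.

(** This and the next lemma rewrite a path inside a longer one whose vertices
    are listed explicitly, hiding the proofs that the pieces are paths. *)
Lemma pcong_catr p s t u (hs : path (@eqF P) p s) (ht : path (@eqF P) p t)
    (a b : ppath P) :
  pcong (PPath hs) (PPath ht) -> verts a = p :: s ++ u ->
  verts b = p :: t ++ u -> pcong a b.
Proof.
move=> st [ap au] [bp bu]; have [_ e] := pcong_ends st; rewrite /tgt /= in e.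
pose c := PPath (path_cat_last au ap).
have ac : tgt (PPath hs) = src c by [].
have bc : tgt (PPath ht) = src c by rewrite /= e.
have -> : a = pcomp ac by apply: ppath_ext; rewrite /verts /= ap au.
have -> : b = pcomp bc by apply: ppath_ext; rewrite /verts /= bp bu.
by apply: pcong_comp => //; exact: pcong_refl.
Qed.

Lemma pcong_cons p (a b a' b' : ppath P) : pcong a b ->
  verts a' = p :: verts a -> verts b' = p :: verts b -> pcong a' b'.
Proof.
move=> ab [ap au] [bp bu]; have [sab _] := pcong_ends ab.
have pa : path (@eqF P) p [:: src a].
  by have := ppathP a'; rewrite ap au /= => /andP[->].
have h1 : tgt (PPath pa) = src a by [].
have h2 : tgt (PPath pa) = src b by rewrite -sab.
have -> : a' = pcomp h1 by apply: ppath_ext; rewrite /verts /= ap au.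
have -> : b' = pcomp h2 by apply: ppath_ext; rewrite /verts /= bp bu sab.
by apply: pcong_comp => //; exact: pcong_refl.
Qed.

Lemma tgt_prestr x (a : ppath P) :
  tgt (prestr x a) = foldl (@theta P) (x |> src a) (rest a) /\
  tgt (prestr x a) |> tgt a = tgt (prestr x a).
Proof.
rewrite /tgt /=.
have -> y (s : seq P) : last y (scanl (@theta P) y s) = foldl (@theta P) y s.
  by elim: s y => /=.
split=> //; case: a => p s _ /=.
by elim: s p x => [|q s IHs] p x /=; rewrite ?th2.
Qed.

Lemma prestr_comp x (a b : ppath P) (ab : tgt a = src b)
    (ab' : tgt (prestr x a) = src (prestr (tgt (prestr x a)) b)) :
  prestr x (pcomp ab) = pcomp ab'.
Proof.
have [e1 e2] := tgt_prestr x a.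
by apply: ppath_ext; rewrite /verts /= scanl_cat -e1 -ab e2.
Qed.

(** Restriction maps each generating pair to one of the same kind.  For the
    third kind, the restriction to y <= e of the pair for a p-linked (e, f) is
    the pair for (y, y theta_p theta_f), which is again p-linked. *)
Lemma prestr_cong x (a b : ppath P) :
  pcong a b -> pcong (prestr x a) (prestr x b).
Proof.
move=> ab; elim: ab x => [{}a {}b ab|{}a|{}a {}b _ IH|{}a {}b c _ ab _ bc
       |{}a a' {}b b' ab ab' aa IHa _ IHb] x; last first.
- have E c d (cd : tgt c = src d) :
      tgt (prestr x c) = src (prestr (tgt (prestr x c)) d).
    by rewrite /= -cd; have [] := tgt_prestr x c.
  rewrite (prestr_comp ab (E _ _ ab)) (prestr_comp ab' (E _ _ ab')).
  apply: pcong_comp; first exact: IHa.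
  have [_ <-] := pcong_ends (IHa x); exact: IHb.
- exact: pcong_trans (ab x) (bc x).
- exact: pcong_sym.
- exact: pcong_refl.
case: a b ab => [a s ps] [b t pt]; rewrite /verts /=.
move es: (a :: s) => s'; move et: (b :: t) => t' st.
case: st es et ps pt => [p|p q pq|p e f _] [-> ->] [-> ->] ps pt;
  apply: pcong_gen; rewrite /verts /=.
- by rewrite th2; exact: PGen1.
- have /eqFP[pE _] := pq; rewrite th4 -pE; apply: PGen2.
  exact: eqF_step pq (th2 _ _).
- case/and3P: ps => /eqFP[eE _] _ _; case/andP: pt => ef _.
  move: (x |> e) (th2 e x) => y ye.
  have pe : p |> e = e by rewrite -(th3 e p) -eE.
  have -> : y |> (e |> p) = y |> p by rewrite -th4 -{1}ye (th4 e p) pe ye.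
  have -> : y |> (f |> p) |> f = y |> p |> f by rewrite -th4 th5.
  have <- : y |> p |> f |> p = y |> (f |> p) by rewrite th4.
  apply: PGen3; split; first by rewrite -[in RHS]th4 !th3.
  by rewrite th4; have /eqFP[] := eqF_step ef ye.
Qed.

Lemma lactP p (b : ppath P) : path (@eqF P) (src b |> p) (verts (prestr p b)).
Proof. by rewrite /= eqF_theta; exact: prestrP. Qed.

(** The product of the path (p) with b. *)
Definition lact p (b : ppath P) : ppath P := PPath (lactP p b).

Lemma lact_cong p (a b : ppath P) : pcong a b -> pcong (lact p a) (lact p b).
Proof.
move=> ab; have [e _] := pcong_ends ab.
apply: (pcong_cons (p := src a |> p) (prestr_cong p ab)); rewrite /verts //=.
by rewrite e.
Qed.

Lemma lact_id p (b : ppath P) : src b |> p = src b -> pcong (lact p b) b.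
Proof.
move=> bp; have pb := theta_above bp.
have h : path (@eqF P) (src b) [:: src b].
  by rewrite /= andbT; apply/eqFP; rewrite /leF th1.
apply: (@pcong_catr (src b) [:: src b] [::] (rest b) h isT).
- exact/pcong_gen/PGen1.
- by rewrite /verts /= bp /verts /= pb scanl_theta_id ?ppathP.
- by [].
Qed.

(** If b starts below q, only the part q theta_p of p acts on b; here the two
    paths are equal, not merely congruent. *)
Lemma lact_restr p q (b : ppath P) :
  src b |> q = src b -> lact p b = lact (q |> p) b.
Proof.
case: b => v s vs /= vq; apply: ppath_ext; rewrite /verts /= /verts /=.
have ev x : x |> v = x |> q |> v |> q by rewrite th4 vq.
have e : q |> p |> v = p |> v by rewrite (ev p) (ev (q |> p)) th3.
by rewrite e -(th4 p q) -[in RHS]vq th5 vq.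
Qed.

(** Acting by p, q, p yields the path (h, x, z, k, ...), and acting by q theta_p
    yields (h, k, ...) with the same continuation.  Now (x, k) is p-linked with
    x theta_p = h and k theta_p = z, so that z may be replaced by h; then
    (h, x, h) collapses to (h). *)
Lemma lact_conj p q (b : ppath P) :
  pcong (lact p (lact q (lact p b))) (lact (q |> p) b).
Proof.
case: b => b1 s bs.
pose v := b1 |> p; pose w := p |> b1; pose t := q |> p.
pose x := p |> (v |> q); pose z := p |> q |> v.
pose k := t |> b1; pose h := v |> q |> p.
have vw y : y |> v |> w = y |> p |> b1 := theta_swap y p b1.
have xz : x |> (q |> v) = z := theta_swap p q v.
have zq : z |> (q |> v) = z by rewrite -xz th2.
have zk : z |> w = k by rewrite /z vw th3.
have [zqw kqw] := theta_step w zq.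
have h_t : b1 |> t = h by rewrite /h /v /t th4.
have kz : k |> p = z by rewrite /z /v -(th4 p b1) th3.
have xh : x |> p = h by rewrite /x /h th3.
have e1 : verts (lact p (lact q (lact p (PPath bs)))) =
    [:: h; x; z; k] ++ scanl (@theta P) k s.
  rewrite /verts /= /verts /= /verts /= -/v -/w -/h -/x xz zqw zk.
  rewrite !scanl_theta //; first by rewrite -zk th2.
  by rewrite -zk.
have e2 : verts (lact t (PPath bs)) = [:: h; k] ++ scanl (@theta P) k s.
  by rewrite /verts /= /verts /= h_t.
have /andP[hk _] := verts_path e2.
have /and4P[hx xz' zk' _] := verts_path e1.
have /eqFP[_ kE] := hk; have /eqFP[xE _] := xz'.
have xk : linked p x k by split; [rewrite xh|rewrite kz].
have xh' : eqF x h by rewrite eqF_sym.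
have p1 : path (@eqF P) x [:: z; k] by rewrite /= xz' zk'.
have p2 : path (@eqF P) x [:: h; k] by rewrite /= xh' hk.
have p3 : path (@eqF P) h [:: x; h] by rewrite /= hx xh'.
have p4 : path (@eqF P) h [:: x; h; k] by rewrite /= hx xh' hk.
have p5 : path (@eqF P) h [:: x; z; k] by rewrite /= hx xz' zk'.
have p6 : path (@eqF P) h [:: k] by rewrite /= hk.
apply: (@pcong_catr h [:: x; z; k] [:: k] (scanl (@theta P) k s) p5 p6) => //.
apply: (@pcong_trans _ _ (PPath p4)).
  apply: (@pcong_cons h (PPath p1) (PPath p2)) => //.
  apply/pcong_sym/pcong_gen; rewrite /verts /= -{1}xh -kz; exact: PGen3.
apply: (@pcong_catr h [:: x; h] [::] [:: k] p3 isT) => //.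
exact/pcong_gen/PGen2.
Qed.

Definition pone p : ppath P := @PPath P p [::] isT.

(** The extra point [None] plays the role of an identity of PG(P): without it,
    elements of PG(P) could act in the same way. *)
Definition PG_lact p (c : option (PG P)) : option (PG P) :=
  Some (PG_class (if c is Some c' then lact p (PG_repr c') else pone p)).

Lemma PG_lactE p (b : ppath P) :
  PG_lact p (Some (PG_class b)) = Some (PG_class (lact p b)).
Proof. by congr Some; apply/PG_classP/lact_cong/PG_repr_cong. Qed.

Definition transformations (T : Type) : semigroup :=
  @Semigroup (T -> T) (fun f g c => f (g c)) (fun _ _ _ => erefl).

Lemma PG_lact_repr : representation (S := transformations _) PG_lact.
Proof.
have onC (F G : option (PG P) -> option (PG P)) :
    (forall b, F (Some (PG_class b)) = G (Some (PG_class b))) ->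
    F None = G None -> F = G.
  by move=> FG0 FGs; apply: funext => -[c|//]; rewrite -(PG_reprK c).
have idem p c : PG_lact p (PG_lact p c) = PG_lact p c.
  have H b : src b |> p = src b ->
      PG_lact p (Some (PG_class b)) = Some (PG_class b).
    by move=> bp; rewrite PG_lactE; congr Some; exact/PG_classP/lact_id.
  case: c => [c|]; last by rewrite [PG_lact p None]/PG_lact H //= th1.
  by rewrite -(PG_reprK c) PG_lactE H //= th2.
have sq1 p q b :
    PG_lact p (PG_lact q (Some (PG_class b))) =
    PG_lact (q |> p) (PG_lact q (Some (PG_class b))).
  rewrite !PG_lactE; congr (Some (PG_class _)); apply: lact_restr.
  exact: th2.
have conj1 p q b :
    PG_lact p (PG_lact q (PG_lact p (Some (PG_class b)))) =
    PG_lact (q |> p) (Some (PG_class b)).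
  by rewrite !PG_lactE; congr Some; exact/PG_classP/lact_conj.
have one q : PG_lact q None = PG_lact q (Some (PG_class (pone q))).
  by rewrite -(idem q None).
split=> /= [p|p q|p q]; apply: onC => [b|].
- exact: idem.
- exact: idem.
- by rewrite [PG_lact q (Some _)]PG_lactE conj1 -PG_lactE -sq1.
- by rewrite one [PG_lact q (Some _)]PG_lactE conj1 -PG_lactE -sq1.
- exact: conj1.
- rewrite (one p) conj1 one /= !PG_lactE; congr Some; apply/PG_classP.
  have h : path (@eqF P) (q |> p) [:: q |> p].
    by rewrite /= andbT; apply/eqFP; rewrite /leF th1.
  apply: (@pcong_catr (q |> p) [:: q |> p] [:: q |> p] [::] h h) => //.
  + exact: pcong_refl.
  + by rewrite /verts /= /verts /= -th4 th1 th2 th3.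
  + by rewrite /verts /= /verts /= th1.
Qed.

Lemma path_prod_lact (a : ppath P) :
  path_prod (S := transformations _) PG_lact a None = Some (PG_class a).
Proof.
case: a => p s; elim: s p => [|q s IHs] p ps.
  by congr (Some (PG_class _)); apply: ppath_ext.
have /= /andP[/eqFP[pq qp] qs] := ps.
have -> : path_prod (S := transformations _) PG_lact (PPath ps) None =
   PG_lact p (path_prod (S := transformations _) PG_lact (PPath qs) None).
  by [].
rewrite IHs PG_lactE; congr (Some (PG_class _)); apply: ppath_ext.
by rewrite /verts /= /verts /= -pq -qp scanl_theta_id.
Qed.

Definition PG_action (c : PG P) : transformations (option (PG P)) :=
  path_prod (S := transformations _) PG_lact (PG_repr c).

Lemma PG_actionE (a : ppath P) :
  PG_action (PG_class a) = path_prod (S := transformations _) PG_lact a.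
Proof. exact/(path_prod_cong PG_lact_repr)/PG_repr_cong. Qed.

Lemma PG_action_inj : injective PG_action.
Proof.
move=> c d; rewrite -(PG_reprK c) -(PG_reprK d) !PG_actionE => ab.
have := path_prod_lact (PG_repr c); rewrite ab path_prod_lact.
by move/(congr1 (odflt c)).
Qed.

Lemma PG_actionM c d :
  PG_action (PG_mul c d) =
  sg_mul (s := transformations _) (PG_action c) (PG_action d).
Proof.
by rewrite [PG_mul c d]/PG_mul PG_actionE (path_prod_pprod _ _ PG_lact_repr).
Qed.

Lemma pprod_cong (a a' b b' : ppath P) :
  pcong a a' -> pcong b b' -> pcong (pprod a b) (pprod a' b').
Proof.
move=> aa bb; apply/PG_classP/PG_action_inj.
rewrite !PG_actionE !(path_prod_pprod _ _ PG_lact_repr).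
by rewrite (path_prod_cong PG_lact_repr aa) (path_prod_cong PG_lact_repr bb).
Qed.

Lemma PG_mulE (a b : ppath P) :
  PG_mul (PG_class a) (PG_class b) = PG_class (pprod a b).
Proof. by apply/PG_classP/pprod_cong; exact: PG_repr_cong. Qed.

Lemma PG_starE (a : ppath P) : PG_star (PG_class a) = PG_class (prev a).
Proof. by apply/PG_classP/prev_cong; exact: PG_repr_cong. Qed.

Lemma prev_pprod (a b : ppath P) :
  prev (pprod a b) = pprod (prev b) (prev a).
Proof.
apply: ppath_ext; rewrite verts_prev !verts_pprod rev_cat revK prevK.
by rewrite !tgt_prev.
Qed.

(** * PG(P) as a regular *-semigroup *)

Lemma PG_rss_laws : rss_laws (@PG_mul P) (@PG_star P).
Proof.
split.
- by move=> c d e; apply: PG_action_inj; rewrite !PG_actionM sg_mulA.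
- by move=> c; rewrite -(PG_reprK c) !PG_starE prevK.
- move=> c; rewrite -(PG_reprK c) PG_starE !PG_mulE.
  apply: PG_action_inj; rewrite !PG_actionE !(path_prod_pprod _ _ PG_lact_repr).
  rewrite (path_prodS PG_lact_repr).
  exact: (seq_prod_first PG_lact_repr).
- move=> c d; rewrite -(PG_reprK c) -(PG_reprK d) PG_mulE !PG_starE PG_mulE.
  by rewrite prev_pprod.
Qed.

Definition PG_semigroup : semigroup := Semigroup (rss_lawA PG_rss_laws).

Definition PG_one p : PG P := PG_class (pone p).

Lemma PG_one_repr : representation (S := PG_semigroup) PG_one.
Proof.
have act p : PG_action (PG_one p) = PG_lact p by rewrite PG_actionE.
have := PG_lact_repr; case=> lI lQ lC.
split=> [p|p q|p q]; apply: PG_action_inj; rewrite !PG_actionM !act.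
- exact: lI.
- exact: lQ.
- exact: lC.
Qed.

Lemma path_prod_PG_one (a : ppath P) :
  path_prod (S := PG_semigroup) PG_one a = PG_class a.
Proof.
apply: PG_action_inj; rewrite PG_actionE /path_prod.
elim: (rest a) (src a) => [|q s IHs] p /=; first by rewrite PG_actionE.
by rewrite PG_actionM IHs PG_actionE.
Qed.

Definition pedge p q (pq : eqF p q) : ppath P :=
  @PPath P p [:: q] (introT andP (conj pq isT)).

Lemma PG_edgeE p q (pq : eqF p q) :
  PG_class (pedge pq) = PG_mul (PG_one p) (PG_one q).
Proof. by rewrite -path_prod_PG_one. Qed.

Lemma PG_edge_idem p q (pq : eqF p q) :
  PG_mul (PG_class (pedge pq)) (PG_class (pedge pq)) = PG_class (pedge pq).
Proof. by rewrite PG_edgeE; exact: (repr_sq PG_one_repr). Qed.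

Lemma verts_ends (a : ppath P) p s :
  verts a = p :: s -> src a = p /\ tgt a = last p s.
Proof. by case: a => q t qt [<- <-]. Qed.

Lemma verts_pprod_one p q :
  verts (pprod (pone p) (pone q)) = [:: q |> p; p |> q].
Proof. by rewrite verts_pprod /verts /= /tgt /= /rev /= !th2. Qed.

Lemma verts_pprod_edge p q u v (pq : eqF p q) (uv : eqF u v) :
  verts (pprod (pedge pq) (pedge uv)) =
  [:: u |> q |> p; u |> q; q |> u; q |> u |> v].
Proof. by rewrite verts_pprod /verts /= /tgt /= /rev /= !th2. Qed.

(** For an idempotent c, also c^* is idempotent, so c = (c c^* ) (c^* c), a
    product of the projections at the two ends of a.  Comparing the ends of this
    product with those of a shows that the ends of a are F-related. *)
Lemma PG_idem_edge (a : ppath P) :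
  PG_mul (PG_class a) (PG_class a) = PG_class a ->
  exists pq : eqF (src a) (tgt a), PG_class a = PG_class (pedge pq).
Proof.
set c := PG_class a => cc; have [mulA _ mulR starM] := PG_rss_laws.
have mulS b : PG_mul (PG_class b) (PG_class (prev b)) = PG_one (src b).
  have := path_prodS PG_one_repr b; rewrite !path_prod_PG_one; exact.
have aS : PG_mul c (PG_star c) = PG_one (src a) by rewrite PG_starE mulS.
have Sa : PG_mul (PG_star c) c = PG_one (tgt a).
  by have := mulS (prev a); rewrite prevK PG_starE.
have cE : c = PG_mul (PG_one (src a)) (PG_one (tgt a)).
  rewrite -aS -Sa mulA -(mulA c) -starM cc.
  by rewrite mulR.
have := cE; rewrite PG_mulE => /PG_classP/pcong_ends[].
have [-> ->] := verts_ends (verts_pprod_one (src a) (tgt a)) => h1 h2.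
have pq : eqF (src a) (tgt a) by apply/eqFP; split.
by exists pq; rewrite PG_edgeE.
Qed.

Lemma repr_edge_fixl (S : semigroup) (f : P -> S) p q u v :
  representation f -> leF v u -> q |> v = q ->
  sg_mul (sg_mul (f p) (f q)) (sg_mul (f u) (f v)) = sg_mul (f p) (f q).
Proof.
move=> fR vu qv; have [qvK _] := repr_below fR qv.
have vuv : sg_mul (sg_mul (f v) (f u)) (f v) = f v.
  by rewrite (repr_conj fR) -vu.
rewrite -sg_mulA; congr sg_mul.
transitivity (sg_mul (f q) (sg_mul (sg_mul (f v) (f u)) (f v))).
  by rewrite !sg_mulA qvK.
by rewrite vuv.
Qed.

Lemma PG_mul_edge_fixl p q u v (pq : eqF p q) (uv : eqF u v) :
  q |> v = q ->
  PG_mul (PG_class (pedge pq)) (PG_class (pedge uv)) = PG_class (pedge pq).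
Proof.
have /eqFP[_ vu] := uv; rewrite !PG_edgeE.
exact: (repr_edge_fixl p PG_one_repr vu).
Qed.
End ProjectionAlgebra.

Lemma PG_is_well_defined : PG_well_defined.
Proof. by split=> P; [exact: pprod_cong|exact: PG_rss_laws]. Qed.

(** * Green's relations in a semigroup *)

Section Green.
Variable S : semigroup.
Local Notation "a * b" := (sg_mul a b).
Implicit Types a b c x : S.

(** No identity is adjoined, which gives the usual relations on regular
    elements; on other elements the relations need not be reflexive. *)
Definition greenR a b : Prop := (exists x, a * x = b) /\ (exists y, b * y = a).
Definition greenL a b : Prop := (exists x, x * a = b) /\ (exists y, y * b = a).

Lemma greenR_sym a b : greenR a b -> greenR b a. Proof. by case. Qed.
Lemma greenL_sym a b : greenL a b -> greenL b a. Proof. by case. Qed.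

Lemma greenR_trans b a c : greenR a b -> greenR b c -> greenR a c.
Proof.
case=> [[x ab] [y ba]] [[z bc] [t cb]]; split.
  by exists (x * z); rewrite sg_mulA ab.
by exists (t * y); rewrite sg_mulA cb.
Qed.

Lemma greenL_trans b a c : greenL a b -> greenL b c -> greenL a c.
Proof.
case=> [[x ab] [y ba]] [[z bc] [t cb]]; split.
  by exists (z * x); rewrite -sg_mulA ab.
by exists (y * t); rewrite -sg_mulA cb.
Qed.

Lemma greenR_mul c a b : greenR a b -> greenR (c * a) (c * b).
Proof.
case=> [[x ab] [y ba]]; split.
  by exists x; rewrite -sg_mulA ab.
by exists y; rewrite -sg_mulA ba.
Qed.

Lemma greenR_idem a b : a * a = a -> greenR a b -> a * b = b.
Proof. by move=> aa [[x <-] _]; rewrite sg_mulA aa. Qed.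

Lemma greenL_idem a b : a * a = a -> greenL a b -> b * a = b.
Proof. by move=> aa [[x <-] _]; rewrite -sg_mulA aa. Qed.

Lemma greenRI a b : a * b = b -> b * a = a -> greenR a b.
Proof. by move=> ab ba; split; [exists b|exists a]. Qed.

Lemma greenLI a b : a * b = a -> b * a = b -> greenL a b.
Proof. by move=> ab ba; split; [exists b|exists a]. Qed.

Lemma regular_inverse : regular_semigroup S ->
  forall a, exists x, a * x * a = a /\ x * a * x = x.
Proof.
move=> Sreg a; have [w aw] := Sreg a; exists (w * a * w).
have e : a * (w * a * w) * a = a by rewrite !sg_mulA aw aw.
split=> //; rewrite -[in RHS]aw; rewrite -!(sg_mulA w); congr (w * _).
by rewrite !sg_mulA !aw.
Qed.
End Green.

(** * Regular *-bosets inside a regular semigroup *)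

(** [s] is the projection in the R-class of [e]. *)
Definition is_dom (E : rsbs) (s : proj E) (e : E) : Prop :=
  bmul (sval s) e = Some e /\ bmul e (sval s) = Some (sval s).

Section RegularBoset.
Variables (E : rsbs) (S : semigroup) (i : E -> idempotent S).
Hypotheses (Sreg : regular_semigroup S) (i_bij : bijective i).
Hypothesis iM : forall e f, boset_mul (i e) (i f) = omap i (bmul e f).

Local Notation "a * b" := (sg_mul a b).
Local Notation "e ^*" := (bstar e).
Local Notation R := (@greenR S).
Local Notation L := (@greenL S).
Implicit Types e f g p q : E.

Definition iota e : S := sval (i e).
Local Notation "# e" := (iota e) (at level 2, e at level 1, format "# e").

Lemma iota_inj e f : #e = #f -> e = f.
Proof. by move/idempotent_inj; exact: (bij_inj i_bij). Qed.

Lemma iota_idem e : #e * #e = #e.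
Proof. exact: (svalP (i e)). Qed.

Lemma iota_surj (a : S) : a * a = a -> exists e, #e = a.
Proof.
move=> aa; have [j _ ij] := i_bij.
by exists (j (Idempotent aa)); rewrite /iota ij.
Qed.

Lemma bmulE e f g : bmul e f = Some g <->
  basic_pair (#e) (#f) /\ #g = #e * #f.
Proof.
rewrite -boset_mulP iM; case: (bmul e f) => [h|] //=; split=> [[->]//|[]].
by move/(bij_inj i_bij) ->.
Qed.

Lemma bmulI e f g :
  basic_pair (#e) (#f) -> #e * #f = #g -> bmul e f = Some g.
Proof. by move=> ef efg; apply/bmulE. Qed.

Lemma bstarM e f g : bmul e f = Some g -> bmul (f^*) (e^*) = Some (g^*).
Proof. exact: (rsb_lawM (rsbs_onP (rsbs_str E))). Qed.

Lemma starM e f g : basic_pair (#e) (#f) ->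
  #e * #f = #g -> #f^* * #e^* = #g^*.
Proof.
move=> ef efg; have h : bmul e f = Some g by exact: bmulI.
by have /bmulE[_ ->] := bstarM h.
Qed.

Lemma bstarK e : e^*^* = e.
Proof. exact: (rsb_lawK (rsbs_onP (rsbs_str E))). Qed.

Lemma star_l e f : #e * #f = #e -> #f^* * #e^* = #e^*.
Proof. by move=> ef; apply: starM => //; left; left. Qed.

Lemma star_r e f : #e * #f = #f -> #f^* * #e^* = #f^*.
Proof. by move=> ef; apply: starM => //; left; right. Qed.

(** The sandwich set of a regular semigroup: a partial product on E is enough to
    detect the equation e g f = e f, which involves products outside E.  The
    element h built from an inverse of e f satisfies this equation, and passes
    it on to every maximal g. *)
Lemma sandwichI e f g : sandwich (@bmul E) e f g <->
  [/\ #g * #e = #g, #f * #g = #g & #e * #g * #f = #e * #f].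
Proof.
have inME h : in_M (@bmul E) e f h <-> #h * #e = #h /\ #f * #h = #h.
  split=> [[/bmulE[_ he] /bmulE[_ fh]]|[he fh]]; first by rewrite -he -fh.
  by split; apply: bmulI => //; rewrite /basic_pair; tauto.
split.
- case=> /inME[ge fg] gmax.
  have [x [ax xx]] := regular_inverse Sreg (#e * #f).
  have [h hE] : exists h, #h = #f * x * #e.
    by apply: iota_surj; rewrite -[in RHS]xx !sg_mulA.
  have /gmax : in_M (@bmul E) e f h.
    by apply/inME; rewrite hE -sg_mulA iota_idem !sg_mulA iota_idem.
  case=> eh [eg [hf [gf [[/bmulE[_ ehE] /bmulE[_ egE] /bmulE[_ hfE]
    /bmulE[_ gfE]]]]]].
  case=> /bmulE[_ _] /bmulE[_]; rewrite hfE gfE => hfg.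
  have ehf : #e * #h * #f = #e * #f by rewrite -[RHS]ax hE !sg_mulA.
  split=> //; have -> : #e * #g * #f = #e * #h * #f * (#g * #f).
    by rewrite ehf !sg_mulA -(sg_mulA #e #f) fg.
  by rewrite -(sg_mulA #e #h #f) -(sg_mulA #e) -hfg sg_mulA ehf.
- case=> ge fg egf; split; first exact/inME.
  move=> h /inME[he fh].
  have ex e1 e2 : basic_pair #e1 #e2 ->
      exists e3, bmul e1 e2 = Some e3 /\ #e3 = #e1 * #e2.
    move=> b; have [e3 e3E] := iota_surj (@basic_pair_idem S (i e1) (i e2) b).
    by exists e3; split=> //; exact: bmulI.
  have [|eh [m1 ehE]] := ex e h; first by right; right.
  have [|eg [m2 egE]] := ex e g; first by right; right.
  have [|hf [m3 hfE]] := ex h f; first by right; left.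
  have [|gf [m4 gfE]] := ex g f; first by right; left.
  exists eh, eg, hf, gf; split=> //.
  have egh : #eg * #eh = #eh.
    rewrite egE ehE sg_mulA -(sg_mulA #e #g) ge -{1}fh sg_mulA egf.
    by rewrite -sg_mulA fh.
  have hgf : #hf * #gf = #hf.
    rewrite hfE gfE sg_mulA -(sg_mulA #h #f) fg -{1}he -!sg_mulA.
    by rewrite [#e * _]sg_mulA egf sg_mulA he.
  by split; apply: bmulI => //; left; [right|left].
Qed.

Lemma sandwich_star e f g :
  sandwich (@bmul E) e f g -> sandwich (@bmul E) (f^*) (e^*) (g^*).
Proof.
have inM e1 e2 h : in_M (@bmul E) e1 e2 h -> in_M (@bmul E) (e2^*) (e1^*) (h^*).
  by case=> he fh; split; apply: bstarM.
case=> gM gmax; split; first exact: inM.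
move=> h /inM; rewrite !bstarK => /gmax.
case=> eh [eg [hf [gf [[m1 m2 m3 m4] [ehg hgf]]]]].
exists (hf^*), (gf^*), (eh^*), (eg^*); rewrite -[h]bstarK.
by split; [split|split]; apply: bstarM; rewrite ?bstarK.
Qed.

Implicit Types r s t u v y : E.
Definition is_proj p : Prop := p = p^*.

Lemma proj_l p q : is_proj p -> is_proj q -> #p * #q = #p -> #q * #p = #p.
Proof. by move=> pp qq /star_l; rewrite -pp -qq. Qed.

Lemma proj_r p q : is_proj p -> is_proj q -> #p * #q = #q -> #q * #p = #q.
Proof. by move=> pp qq /star_r; rewrite -pp -qq. Qed.

Lemma proj_R_uniq p q : is_proj p -> is_proj q -> R #p #q -> p = q.
Proof.
move=> pp qq pq; apply: iota_inj.
have /(proj_r pp qq) <- := greenR_idem (iota_idem p) pq.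
by rewrite (greenR_idem (iota_idem q) (greenR_sym pq)).
Qed.

Lemma proj_L_uniq p q : is_proj p -> is_proj q -> L #p #q -> p = q.
Proof.
move=> pp qq pq; apply: iota_inj.
have /(proj_l qq pp) <- := greenL_idem (iota_idem p) pq.
by rewrite (greenL_idem (iota_idem q) (greenL_sym pq)).
Qed.

(** That [s] and [t] are projections is a consequence of the axiom: s is
    R-related to e and L-related to e^*, hence its star is too, so that s and
    its star are idempotents in the same H-class. *)
Lemma star_square e : exists s t, is_proj s /\ is_proj t /\
  [/\ #s * #e = #e, #e * #s = #s, #e^* * #t = #t & #t * #e^* = #e^*] /\
  [/\ #e * #t = #e, #t * #e = #t, #s * #e^* = #s & #e^* * #s = #e^*] /\
  (forall g, #g * #e = #g -> #e * #g = #g ->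
     #e^* * (#g * #s) = (#t * #g) * #e^*).
Proof.
have [s [t [[]]]] := rsb_lawE (rsbs_onP (rsbs_str E)) e.
move=> /bmulE[_ /esym se] /bmulE[_ /esym es] /bmulE[_ /esym et].
move=> /bmulE[_ /esym te].
case=> -[] /bmulE[_ /esym et'] /bmulE[_ /esym te'] /bmulE[_ /esym se'].
move=> /bmulE[_ /esym es'] sq.
have sP : is_proj s.
  have sse := star_r es; have se2 := star_l se'; rewrite bstarK in se2.
  have es2 := star_r se; apply: iota_inj; transitivity (#s * #s^*).
    by rewrite -[in RHS]se' -sg_mulA es2.
  by rewrite -[in LHS]se2 sg_mulA se se2.
have tP : is_proj t.
  have te2 := star_l te'; have et2 := star_r te; rewrite bstarK in et2.
  apply: iota_inj; transitivity (#t * #t^*).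
    by rewrite -[in RHS]te' -sg_mulA et2.
  by rewrite -[in LHS]te2 sg_mulA te te2.
exists s, t; do 2 (split=> //); split=> //; split=> // g ge eg.
have [||gs [tg [c [/bmulE[_ gsE] /bmulE[_ tgE] /bmulE[_ c1] /bmulE[_ c2]]]]] :=
  sq g.
- by apply: bmulI => //; left; left.
- by apply: bmulI => //; left; right.
by rewrite -gsE -tgE; exact: etrans (esym c1) c2.
Qed.

Lemma ex_proj_R (a : S) : exists p, is_proj p /\ R #p a.
Proof.
have [w [aw _]] := regular_inverse Sreg a.
have [e eE] : exists e, #e = a * w by apply: iota_surj; rewrite sg_mulA aw.
have [s [t [sP [_ [[se es _ _] _]]]]] := star_square e.
exists s; split=> //; apply: (@greenR_trans _ #e); first exact: greenRI.
by rewrite eE; split; [exists a|exists w].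
Qed.

Lemma ex_proj_L (a : S) : exists p, is_proj p /\ L #p a.
Proof.
have [w [aw _]] := regular_inverse Sreg a.
have [e eE] : exists e, #e = w * a.
  by apply: iota_surj; rewrite -sg_mulA (sg_mulA a) aw.
have [s [t [_ [tP [_ [[et te _ _] _]]]]]] := star_square e.
exists t; split=> //; apply: (@greenL_trans _ #e); first exact: greenLI.
by rewrite eE; split; [exists a; rewrite sg_mulA|exists w].
Qed.

(** With r and t the projections in the R-class and the L-class of a = p q, the
    element sought is the inverse x of a with a x = r and x a = t.  It is
    idempotent because r t = a. *)
Lemma ex_proj_e p q : is_proj p -> is_proj q -> exists e, proj_e p q e.
Proof.
move=> pP qP; pose a := #p * #q.
have [r [rP ra]] := ex_proj_R a; have [t [tP ta]] := ex_proj_L a.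
have ra' : #r * a = a := greenR_idem (iota_idem r) ra.
have at' : a * #t = a := greenL_idem (iota_idem t) ta.
have [[_ _] [y ay]] := ra; have [_ [z za]] := ta.
have pr : #p * #r = #r by rewrite -ay !sg_mulA iota_idem.
have tq : #t * #q = #t by rewrite -za -!sg_mulA iota_idem.
have rp := proj_r pP rP pr; have qt := proj_l tP qP tq.
have rt : #r * #t = a.
  by rewrite -[in LHS]rp -[in LHS]qt -!sg_mulA (sg_mulA #p) (sg_mulA #r) ra'.
pose x := z * #r.
have xt : x = #t * y by rewrite /x -ay sg_mulA za.
have tx : #t * x = x by rewrite xt sg_mulA iota_idem.
have xr : x * #r = x by rewrite /x -sg_mulA iota_idem.
have xa : x * a = #t by rewrite /x -sg_mulA ra'.
have ax : a * x = #r by rewrite xt sg_mulA at'.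
have [e eE] : exists e, #e = x.
  apply: iota_surj; transitivity (x * #r * (#t * x)); first by rewrite xr tx.
  by rewrite -sg_mulA (sg_mulA #r) rt sg_mulA xa.
have xp : x * #p = x by rewrite -xr -sg_mulA rp.
have qx : #q * x = x by rewrite -tx sg_mulA qt.
have px : #p * x = #r by rewrite -{1}qx sg_mulA.
have xq : x * #q = #t by rewrite -{1}xp -sg_mulA.
exists e; split.
- apply/sandwichI; rewrite eE; split=> //.
  by rewrite px -[in LHS]rp -sg_mulA ra'.
- by exists r; split=> //; apply: bmulI; rewrite ?eE //; right; right.
- by exists t; split=> //; apply: bmulI; rewrite ?eE //; right; left.
Qed.

Lemma proj_eP p q e : proj_e p q e ->
  [/\ #e * #p = #e, #q * #e = #e, #p * #e * #q = #p * #q & exists r t,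
    [/\ is_proj r, is_proj t, #p * #e = #r & #e * #q = #t]].
Proof.
case=> /sandwichI[ep qe peq] [r [/bmulE[_ per] rP]] [t [/bmulE[_ eqt] tP]].
by split=> //; exists r, t; split.
Qed.

Lemma proj_e_green p q e : is_proj p -> is_proj q -> proj_e p q e ->
  R (#p * #e) (#p * #q) /\ L (#e * #q) (#p * #q).
Proof.
move=> pP qP /proj_eP[ep qe peq _]; split; split.
- by exists #q.
- by exists #e; rewrite -sg_mulA qe.
- by exists #p; rewrite sg_mulA.
- by exists #e; rewrite sg_mulA ep.
Qed.

Lemma uniq_proj_e p q e e' : is_proj p -> is_proj q ->
  proj_e p q e -> proj_e p q e' -> e = e'.
Proof.
move=> pP qP h h'.
have [pe eq] := proj_e_green pP qP h; have [pe' eq'] := proj_e_green pP qP h'.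
have [ep qe peq [r [t [rP tP per eqt]]]] := proj_eP h.
have [ep' qe' peq' [r' [t' [rP' tP' per' eqt']]]] := proj_eP h'.
have rr : r = r'.
  apply: proj_R_uniq => //; rewrite -per -per'.
  exact: greenR_trans pe (greenR_sym pe').
have tt : t = t'.
  apply: proj_L_uniq => //; rewrite -eqt -eqt'.
  exact: greenL_trans eq (greenL_sym eq').
apply: iota_inj.
transitivity (#e' * #e).
  by rewrite -[LHS]iota_idem -{2}qe sg_mulA eqt tt -eqt' -sg_mulA qe.
by rewrite -ep' -sg_mulA per rr -per' sg_mulA ep' iota_idem.
Qed.

Lemma unique_proj_eP : unique_proj_e E.
Proof.
move=> p q pP qP; have [e pqe] := ex_proj_e pP qP.
by exists e; split=> // e' pqe'; exact: uniq_proj_e pqe'.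
Qed.

(** * The projection algebra of a regular *-boset *)

Variable he : unique_proj_e E.
Local Notation "q |> p" := (proj_theta he q p).
Local Notation "$ p" := (iota (sval p))
  (at level 2, p at level 1, format "$ p").
Implicit Types a b c x z w : proj E.

Lemma theta_R a b : R $(a |> b) ($b * $a).
Proof.
have /proj_thetaP[e [bae /bmulE[_ ->]]] := erefl (a |> b).
by have [] := proj_e_green (svalP b) (svalP a) bae.
Qed.

Lemma theta_uniq a b c : R $c ($b * $a) -> a |> b = c.
Proof.
move=> cba; apply: proj_inj; apply: proj_R_uniq; [exact: svalP|exact: svalP|].
exact: greenR_trans (theta_R _ _) (greenR_sym cba).
Qed.

Lemma proj_e_star p q e :
  is_proj p -> is_proj q -> proj_e p q e -> proj_e q p (e^*).
Proof.
move=> pP qP [/sandwich_star]; rewrite -pP -qP.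
move=> sw [r [/bstarM per rP]] [t [/bstarM eqt tP]].
rewrite /= -pP -rP in per; rewrite /= -qP -tP in eqt.
by split=> //; [exists t|exists r].
Qed.

(** The projection e b is defined through e(a, b), while theta applied to a uses
    e(b, a); they agree because e(b, a) is the star of e(a, b). *)
Lemma theta_e a b e : proj_e (sval a) (sval b) e ->
  $(b |> a) = $a * #e /\ $(a |> b) = #e * $b.
Proof.
move=> abe; have [_ [r [per rP]] [t [eqt tP]]] := abe.
have /bmulE[_ <-] := per; have /bmulE[_ <-] := eqt.
split.
  have -> : b |> a = exist _ r rP by apply/proj_thetaP; exists e.
  by [].
have -> : a |> b = exist _ t tP; last by [].
apply/proj_thetaP; exists (e^*); split.
  by apply: proj_e_star abe; exact: svalP.
by have := bstarM eqt; rewrite -[X in Some X]tP -[X in _ X _ = _](svalP b).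
Qed.

Lemma theta_mul a b : $(b |> a) * $(a |> b) = $a * $b.
Proof.
have [e abe] := ex_proj_e (svalP a) (svalP b).
have [-> ->] := theta_e abe.
have [ea be aeb _] := proj_eP abe.
by rewrite sg_mulA -(sg_mulA $a) iota_idem.
Qed.

Lemma theta_idem_ex a b : exists e,
  [/\ $(a |> b) * #e = #e, #e * $(a |> b) = $(a |> b),
      #e * $(b |> a) = #e & $(b |> a) * #e = $(b |> a)].
Proof.
have [e abe] := ex_proj_e (svalP a) (svalP b).
have [-> ->] := theta_e abe; have [ea be _ _] := proj_eP abe; exists e.
split.
- by rewrite -sg_mulA be iota_idem.
- by rewrite sg_mulA iota_idem.
- by rewrite sg_mulA ea iota_idem.
- by rewrite -sg_mulA iota_idem.
Qed.

(** Let e be in the R-class of s and in the L-class of t, and y <= t.  Then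
    g = e y is an idempotent below e, and the axiom on squares, applied to it,
    shows that g s is L-related to the star of g.  As g s is R-related to g, it
    is the projection in the R-class of g.  Hence g = e(y, s), and g s is the
    projection y theta_s, which lies in the R-class of s y.  The second claim is
    that going on with e^* leads back to y. *)
Lemma square_below e s t y :
  #s * #e = #e -> #e * #s = #s -> #e * #t = #e -> #t * #e = #t ->
  is_proj s -> is_proj t -> is_proj y -> #t * #y = #y ->
  R (#e * #y) (#s * #y) /\ R (#e^* * (#e * #y)) #y.
Proof.
move=> se es et te sP tP yP ty.
have [s0 [t0 [s0P [t0P [[s0e es0 et0 te0] [[et0' t0e s0e' es0'] sq]]]]]] :=
  star_square e.
have ss : s0 = s.
  apply: proj_R_uniq => //; apply: (@greenR_trans _ #e); first exact: greenRI.
  exact: greenRI.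
have tt : t0 = t.
  apply: proj_L_uniq => //; apply: (@greenL_trans _ #e); first exact: greenLI.
  exact: greenLI.
subst s0 t0; clear s0P t0P s0e es0 et0' t0e.
have yt := proj_r tP yP ty.
have ye : #y * #e = #y by rewrite -{1}yt -sg_mulA te yt.
have [g gE] : exists g, #g = #e * #y.
  by apply: iota_surj; rewrite sg_mulA -(sg_mulA #e) ye -sg_mulA iota_idem.
have ge : #g * #e = #g by rewrite gE -sg_mulA ye.
have eg : #e * #g = #g by rewrite gE sg_mulA iota_idem.
have gy : #g * #y = #g by rewrite gE -sg_mulA iota_idem.
have sg : #s * #g = #g by rewrite gE sg_mulA se.
have tg : #t * #g = #y by rewrite gE sg_mulA te ty.
have yg : #y * #g = #y by rewrite gE sg_mulA ye iota_idem.
have {}sq : #e^* * (#g * #s) = #y * #e^* by rewrite sq // tg.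
have gs_g : R (#g * #s) #g.
  by split; [exists #e; rewrite -sg_mulA se|exists #s].
have ey' : #e^* * #y = #y by rewrite -ty sg_mulA et0.
split; last first.
  rewrite -gE; apply: greenR_trans (greenR_mul _ (greenR_sym gs_g)) _.
  by rewrite sq; split; [exists #t; rewrite -sg_mulA et0 yt|exists #e^*].
have [h hE] : exists h, #h = #g * #s.
  by apply: iota_surj; rewrite sg_mulA -(sg_mulA #g) sg iota_idem.
have gsE : #g^* = #e^* * #h.
  rewrite hE sq [in RHS]yP; apply: esym.
  by apply: starM; [right; right|].
have hP : is_proj h.
  have [s1 [t1 [s1P [_ [[s1g gs1 _ _] [[_ _ s1g' gs1'] _]]]]]] := star_square g.
  suff -> : h = s1 by [].
  have hg : R #h #g by rewrite hE.
  have hgs : L #h #g^*.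
    have hh : #h * #e^* = #h by rewrite hE -sg_mulA s0e'.
    by apply: greenLI; rewrite gsE -?sg_mulA ?iota_idem // sg_mulA hh iota_idem.
  apply: iota_inj.
  have h1 : R #h #s1 by apply: greenR_trans hg _; exact: greenRI.
  have h2 : L #s1 #h by apply: greenL_trans (greenL_sym hgs); exact: greenLI.
  by rewrite -(greenL_idem (iota_idem s1) h2) (greenR_idem (iota_idem h) h1).
have ysg : proj_e y s g.
  split; first by apply/sandwichI; split=> //; rewrite yg.
  - by exists y; split=> //; apply: bmulI => //; left; left.
  - by exists h; split=> //; apply: bmulI => //; right; left.
have [_ th] := @theta_e (exist _ y yP) (exist _ s sP) g ysg.
have := theta_R (exist _ y yP) (exist _ s sP); rewrite th /= => gss.
by rewrite -gE; apply: greenR_trans (greenR_sym gs_g) gss.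
Qed.

(** Put r = a |> b and t = b |> a, so that b a = r t and a b = t r.  The last
    three laws hold because r t acts below r like an identity up to R
    ([trivial_below]): by [square_below], multiplication by t may be replaced
    there by multiplication by an idempotent e in the R-class of t and the
    L-class of r, and the multiplication by r that follows by e^*. *)
Lemma proj_theta_laws : projalg_laws (proj_theta he).
Proof.
have le a b : $b * $(a |> b) = $(a |> b).
  have [[x <-] _] := greenR_sym (theta_R a b).
  by rewrite !sg_mulA iota_idem.
have ge a b : $(a |> b) * $b = $(a |> b).
  by apply: proj_r (le a b); exact: svalP.
have trivial_below a b c : $(a |> b) * $c = $c ->
    R ($(a |> b) * ($(b |> a) * $c)) $c.
  move=> rc; have [e [te et er re]] := theta_idem_ex b a.
  have [e1 e2] := square_below te et er re (svalP _) (svalP _) (svalP c) rc.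
  have et' := star_r te; have te' := star_r et.
  have re' := star_l er; have er' := star_l re.
  rewrite -!(svalP (a |> b)) in re' er'; rewrite -!(svalP (b |> a)) in te' et'.
  have [e3 _] := square_below re' er' et' te' (svalP _) (svalP _)
    (svalP (c |> (b |> a))) (le _ _).
  have cr := theta_R c (b |> a).
  apply: greenR_trans (greenR_mul _ (greenR_sym cr)) _.
  apply: greenR_trans (greenR_sym e3) _.
  apply: greenR_trans (greenR_mul _ cr) _.
  by apply: greenR_trans (greenR_mul _ (greenR_sym e1)) e2.
have loop a b c :
    R ($(a |> b) * ($(b |> a) * ($(a |> b) * $c))) ($(a |> b) * $c).
  have cr := theta_R c (a |> b).
  apply: greenR_trans (greenR_sym (greenR_mul _ (greenR_mul _ cr))) _.
  by apply: greenR_trans cr; apply: trivial_below; exact: le.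
have conj a b c : R ($b * ($a * ($b * $c))) ($(a |> b) * $c).
  have -> : $b * ($a * ($b * $c)) = $b * $a * ($a * $b) * $c.
    by rewrite !sg_mulA -(sg_mulA $b $a $a) iota_idem.
  rewrite -(theta_mul a b) -(theta_mul b a) -!sg_mulA.
  by rewrite (sg_mulA $(b |> a) $(b |> a)) iota_idem; exact: loop.
split.
- by move=> p; apply: theta_uniq; split; exists $p; rewrite !iota_idem.
- move=> p x; apply: theta_uniq; rewrite le.
  by split; exists $(x |> p); exact: iota_idem.
- move=> p q; apply: theta_uniq.
  apply: greenR_trans (greenR_mul _ (greenR_sym (theta_R _ _))).
  by have /greenR_sym := conj q p p; rewrite ge iota_idem.
- move=> p q x; apply: theta_uniq.
  apply: greenR_trans (theta_R _ _) _.
  apply: greenR_trans (greenR_sym (conj _ _ _)) _.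
  apply: greenR_mul; apply: greenR_sym.
  apply: greenR_trans (theta_R _ _) _; apply: greenR_mul; exact: theta_R.
- move=> p q x; apply: theta_uniq.
  have e1 : R $(x |> p |> q) ($q * ($p * $x)).
    by apply: greenR_trans (theta_R _ _) _; apply: greenR_mul; exact: theta_R.
  have e2 : R ($p * $(x |> p |> q)) $(x |> p |> q |> p).
    exact: greenR_sym (theta_R _ _).
  apply: greenR_trans (greenR_mul _ e2).
  apply: (greenR_trans e1); apply: greenR_sym.
  apply: (greenR_trans (greenR_mul _ (greenR_mul _ e1))).
  rewrite !(sg_mulA $q $p) -(theta_mul q p) -!sg_mulA; apply: greenR_mul.
  exact: loop.
Qed.

Lemma is_domE (s : proj E) e : is_dom s e <-> $s * #e = #e /\ #e * $s = $s.
Proof.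
split=> [[/bmulE[_ se] /bmulE[_ es]]|[se es]]; first by rewrite -se -es.
by split; apply: bmulI => //; left; right.
Qed.

Lemma is_dom_starE (t : proj E) e :
  is_dom t (e^*) <-> #e * $t = #e /\ $t * #e = $t.
Proof.
rewrite is_domE; split=> -[h1 h2].
  have h3 := star_r h1; have h4 := star_r h2.
  by rewrite bstarK -(svalP t) in h3 h4.
by have h3 := star_l h1; have h4 := star_l h2; rewrite -(svalP t) in h3 h4.
Qed.

Lemma is_dom_R (s : proj E) e : is_dom s e -> R $s #e.
Proof. by move=> /is_domE[]; exact: greenRI. Qed.

Lemma ex_is_dom e : exists s : proj E, is_dom s e.
Proof.
have [s [_ [sP [_ [[se es _ _] _]]]]] := star_square e.
by exists (exist _ s sP); apply/is_domE.
Qed.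

Lemma is_dom_uniq (s s' : proj E) e : is_dom s e -> is_dom s' e -> s = s'.
Proof.
move=> /is_dom_R se /is_dom_R se'; apply: proj_inj.
apply: proj_R_uniq; [exact: svalP|exact: svalP|].
exact: greenR_trans se (greenR_sym se').
Qed.

Lemma is_dom_theta (s t : proj E) e :
  is_dom s e -> is_dom t (e^*) -> t |> s = s.
Proof.
rewrite -{1}[e]bstarK => /is_dom_starE[_ se] /is_domE[te _].
apply: theta_uniq; split; first by exists $t.
by exists #e^*; rewrite -sg_mulA te.
Qed.

(** An idempotent is determined by its H-class. *)
Lemma dom_cod_inj (s t : proj E) e f : is_dom s e -> is_dom t (e^*) ->
  is_dom s f -> is_dom t (f^*) -> e = f.
Proof.
move=> /is_domE[se es] /is_dom_starE[et te].
move=> /is_domE[sf fs] /is_dom_starE[ft tf].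
apply: iota_inj; transitivity (#f * #e).
  by rewrite -[LHS]se -fs -sg_mulA se.
by rewrite -ft -sg_mulA te.
Qed.

Lemma dom_cod_ex (s t : proj E) : t |> s = s -> s |> t = t ->
  exists e, is_dom s e /\ is_dom t (e^*).
Proof.
move=> ts st; have [e] := theta_idem_ex t s; rewrite st ts => -[h1 h2 h3 h4].
by exists e; split; [apply/is_domE|apply/is_dom_starE].
Qed.

Lemma mul_fixl_cod (t v : proj E) e f : is_dom t (e^*) -> is_dom v (f^*) ->
  bmul e f = Some e <-> t |> v = t.
Proof.
move=> /is_dom_starE[et te] /is_dom_starE[fv vf]; split.
  move=> /bmulE[_ /esym ef].
  have tv : $t * $v = $t by rewrite -te -{1}ef -!sg_mulA fv ef.
  have vt := proj_l (svalP t) (svalP v) tv.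
  by apply: theta_uniq; rewrite vt; split; exists $t; exact: iota_idem.
move=> tv; have vt : $v * $t = $t.
  rewrite -tv; have [[x <-] _] := greenR_sym (theta_R t v).
  by rewrite !sg_mulA iota_idem.
have {}tv := proj_r (svalP v) (svalP t) vt.
have ev : #e * $v = #e by rewrite -et -sg_mulA tv.
have ef : #e * #f = #e by rewrite -{1}ev -sg_mulA vf.
by apply: bmulI => //; left; left.
Qed.

(** In S, e f is R-related to e u = e t u, hence to e (u theta_t), and by
    [square_below] to s (u theta_t). *)
Lemma is_dom_mul (s t u : proj E) e f g :
  is_dom s e -> is_dom t (e^*) -> is_dom u f -> bmul e f = Some g ->
  is_dom (u |> t |> s) g.
Proof.
move=> /is_domE[se es] /is_dom_starE[et te] uf /bmulE[_ gE].
suff pg : R $(u |> t |> s) #g.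
  apply/is_domE; rewrite (greenR_idem (iota_idem _) pg).
  by rewrite (greenR_idem (iota_idem _) (greenR_sym pg)).
rewrite gE; apply: greenR_trans (theta_R _ _) _.
have ty : $t * $(u |> t) = $(u |> t).
  have [[x <-] _] := greenR_sym (theta_R u t).
  by rewrite !sg_mulA iota_idem.
have [e1 _] :=
  square_below se es et te (svalP s) (svalP t) (svalP (u |> t)) ty.
apply: greenR_trans (greenR_sym e1) _.
apply: greenR_trans (greenR_mul _ (theta_R _ _)) _.
by rewrite sg_mulA et; apply: greenR_mul; exact: is_dom_R.
Qed.

Lemma is_dom_proj (p : proj E) : is_dom p (sval p).
Proof. by apply/is_domE; rewrite iota_idem. Qed.

Lemma bmul_basic e f : (exists g, bmul e f = Some g) <->
  (bmul e f = Some e \/ bmul e f = Some f) \/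
  (bmul f e = Some e \/ bmul f e = Some f).
Proof.
have fix_l e1 e2 : bmul e1 e2 = Some e1 <-> #e1 * #e2 = #e1.
  by split=> [/bmulE[_ <-]//|h]; apply: bmulI => //; left; left.
have fix_r e1 e2 : bmul e1 e2 = Some e2 <-> #e1 * #e2 = #e2.
  by split=> [/bmulE[_ <-]//|h]; apply: bmulI => //; left; right.
rewrite !fix_l !fix_r; split=> [[g /bmulE[]] //|b].
have b' : basic_pair #e #f by rewrite /basic_pair; tauto.
have [g gE] := iota_surj (@basic_pair_idem S (i e) (i f) b').
by exists g; apply: bmulI.
Qed.

End RegularBoset.

(** * Regular *-bosets in terms of their projection algebras *)

Lemma regular_boset_iota (E : rsbs) : exists (S : semigroup)
  (i : E -> idempotent S), [/\ regular_semigroup S, bijective i &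
  forall e f, boset_mul (i e) (i f) = omap i (bmul e f)].
Proof.
have [S [Sreg [i [i_bij iM]]]] := rsb_lawB (rsbs_onP (rsbs_str E)).
by exists S, i.
Qed.

Lemma P_is_well_defined : P_well_defined.
Proof.
have h E : unique_proj_e E.
  have [S [i [Sreg i_bij iM]]] := regular_boset_iota E.
  exact: unique_proj_eP Sreg i_bij iM.
split with h => E; have [S [i [Sreg i_bij iM]]] := regular_boset_iota E.
exact: proj_theta_laws Sreg i_bij iM _.
Qed.

Section Domain.
Variables (w : P_well_defined) (E : rsbs).
Local Notation P := (P_obj w E).
Local Notation "e ^*" := (bstar e).
Implicit Types e f g : E.
Implicit Types p s t : P.

Lemma ex_dom e : exists s : P, is_dom s e.
Proof.
have [S [i [Sreg i_bij iM]]] := regular_boset_iota E.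
exact: ex_is_dom i_bij iM e.
Qed.

(** The projection in the R-class of e; the one in the L-class is
    [dom (bstar e)]. *)
Definition dom e : P := sval (cid (ex_dom e)).

Lemma domP e : is_dom (dom e) e.
Proof. exact: (svalP (cid (ex_dom e))). Qed.

Lemma dom_uniq s e : is_dom s e -> dom e = s.
Proof.
have [S [i [Sreg i_bij iM]]] := regular_boset_iota E.
by move=> se; apply: (is_dom_uniq i_bij iM) se; exact: domP.
Qed.

Lemma dom_proj p : dom (sval p) = p.
Proof.
have [S [i [Sreg i_bij iM]]] := regular_boset_iota E.
by apply: dom_uniq; exact: is_dom_proj i_bij iM _.
Qed.

Lemma dom_eqF e : eqF (dom e) (dom (e^*)).
Proof.
have [S [i [Sreg i_bij iM]]] := regular_boset_iota E.
apply/eqFP; rewrite /leF; split; apply: esym.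
  by apply: (is_dom_theta Sreg i_bij iM); exact: domP.
apply: (is_dom_theta Sreg i_bij iM); first exact: domP.
by rewrite bstarK; exact: domP.
Qed.

Lemma dom_inj e f : dom e = dom f -> dom (e^*) = dom (f^*) -> e = f.
Proof.
have [S [i [Sreg i_bij iM]]] := regular_boset_iota E.
move=> ef ef'; apply: (dom_cod_inj i_bij iM (s := dom e) (t := dom (e^*))).
- exact: domP.
- exact: domP.
- by rewrite ef; exact: domP.
- by rewrite ef'; exact: domP.
Qed.

Lemma dom_ex s t : eqF s t -> exists e, dom e = s /\ dom (e^*) = t.
Proof.
have [S [i [Sreg i_bij iM]]] := regular_boset_iota E.
move=> /eqFP[st ts].
have [e [se te]] := dom_cod_ex Sreg i_bij iM (esym st) (esym ts).
by exists e; split; exact: dom_uniq.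
Qed.

Lemma mul_fixl_dom e f :
  bmul e f = Some e <-> dom (e^*) |> dom (f^*) = dom (e^*).
Proof.
have [S [i [Sreg i_bij iM]]] := regular_boset_iota E.
by apply: (mul_fixl_cod Sreg i_bij iM); exact: domP.
Qed.

Lemma dom_mul e f g :
  bmul e f = Some g -> dom g = dom f |> dom (e^*) |> dom e.
Proof.
have [S [i [Sreg i_bij iM]]] := regular_boset_iota E.
move=> efg; apply: dom_uniq.
by apply: (is_dom_mul Sreg i_bij iM) efg; exact: domP.
Qed.

Lemma mul_star e f g : bmul e f = Some g <-> bmul (f^*) (e^*) = Some (g^*).
Proof. by split=> /bstarM; rewrite ?bstarK. Qed.

Lemma mul_basic e f : (exists g, bmul e f = Some g) <->
  (bmul e f = Some e \/ bmul e f = Some f) \/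
  (bmul f e = Some e \/ bmul f e = Some f).
Proof.
have [S [i [Sreg i_bij iM]]] := regular_boset_iota E.
exact: bmul_basic i_bij iM _ _.
Qed.

End Domain.

Lemma dom_hom (w : P_well_defined) (E E' : rsbs) (phi : rsbs_hom E E') (e : E) :
  dom w (phi e) = P_fun phi (dom w e).
Proof.
by apply: dom_uniq; have [se es] := domP w e; split; exact: rsbs_funM.
Qed.

(** * Isomorphisms of regular *-bosets *)

Section BosetBijection.
Variables (E E' : rsbs) (h : E -> E') (k : E' -> E).
Hypotheses (hK : cancel h k) (kK : cancel k h).
Hypothesis hM : forall e f, bmul (h e) (h f) = omap h (bmul e f).
Hypothesis hS : forall e, h (bstar e) = bstar (h e).

Lemma boset_bij_inv e f : bmul (k e) (k f) = omap k (bmul e f).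
Proof.
have := hM (k e) (k f); rewrite !kK => ->.
by case: (bmul (k e) (k f)) => //= g; rewrite hK.
Qed.

Lemma boset_bij_invS e : k (bstar e) = bstar (k e).
Proof. by rewrite -{1}(kK e) -hS hK. Qed.

Lemma boset_bijM e f g : bmul e f = Some g -> bmul (h e) (h f) = Some (h g).
Proof. by rewrite hM => ->. Qed.

Lemma boset_bij_invM e f g : bmul e f = Some g -> bmul (k e) (k f) = Some (k g).
Proof. by rewrite boset_bij_inv => ->. Qed.

Lemma boset_bijW e f g :
  sandwich (@bmul E) e f g -> sandwich (@bmul E') (h e) (h f) (h g).
Proof.
move=> [[ge fg] gmax]; split; first by split; exact: boset_bijM.
move=> x [xe fx].
have [|eh [eg [hf [gf [[m1 m2 m3 m4] [l1 l2]]]]]] := gmax (k x).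
  have := boset_bij_invM xe; have := boset_bij_invM fx; rewrite !hK.
  by split.
exists (h eh), (h eg), (h hf), (h gf); rewrite -(kK x).
by split; [split|split]; exact: boset_bijM.
Qed.

Definition rsbs_hom_bij : rsbs_hom E E' := RsbsHom boset_bijM boset_bijW hS.
End BosetBijection.

(** * The isomorphism from E to the boset of PG(P(E)) *)

Section Unit.
Variables (wP : P_well_defined) (wG : PG_well_defined).

Section Object.
Variable E : rsbs.
Local Notation P := (P_obj wP E).
Local Notation "e ^*" := (bstar e).
Local Notation PGE := (PG_obj wG P).
Local Notation dom := (dom wP).
Implicit Types e f g : E.

Definition dom_edge e : ppath P := pedge (dom_eqF wP e).

Lemma PG_dom_edge_idem e :
  rmul (PG_class (dom_edge e) : PGE) (PG_class (dom_edge e)) =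
  PG_class (dom_edge e).
Proof. exact: PG_edge_idem. Qed.

Definition eta_fun e : forget_obj PGE :=
  Idempotent (S := rss_semigroup PGE) (PG_dom_edge_idem e).

Lemma eta_funS e : eta_fun (e^*) = bstar (eta_fun e).
Proof.
apply: idempotent_inj; rewrite /= /rstar /= PG_starE.
congr PG_class; apply: ppath_ext.
by rewrite verts_prev /verts /= /rev /= bstarK.
Qed.

Lemma eta_fun_inj : injective eta_fun.
Proof.
move=> e f /(congr1 sval) /= /PG_classP/pcong_ends[/= ef].
by rewrite /tgt /= => ef'; exact: dom_inj ef ef'.
Qed.

Lemma eta_fun_surj (c : forget_obj PGE) : exists e, eta_fun e = c.
Proof.
case: c => c cc; rewrite -(PG_reprK c) in cc *.
have [pq E1] := PG_idem_edge cc.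
have [e [es et]] := dom_ex pq.
exists e; apply: idempotent_inj => /=.
by rewrite [RHS]E1; congr PG_class; apply: ppath_ext; rewrite /verts /= es et.
Qed.

(** Both conditions say that dom (e^* ) <= dom (f^* ). *)
Lemma eta_fixl e f : bmul e f = Some e <->
  PG_mul (PG_class (dom_edge e)) (PG_class (dom_edge f)) =
  PG_class (dom_edge e).
Proof.
rewrite (mul_fixl_dom wP); split=> [|].
  exact: PG_mul_edge_fixl.
rewrite PG_mulE => /PG_classP/pcong_ends[_].
have [_ ->] := verts_ends (verts_pprod_edge (dom_eqF wP e) (dom_eqF wP f)).
move=> qE; have {}qE : dom (e^*) |> dom f |> dom (f^*) = dom (e^*) := qE.
by rewrite -qE th2.
Qed.

Lemma eta_fixr e f : bmul e f = Some f <->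
  PG_mul (PG_class (dom_edge e)) (PG_class (dom_edge f)) =
  PG_class (dom_edge f).
Proof.
have [_ lK _ lM] := PG_rss_laws P.
have sE g : PG_class (dom_edge (g^*)) = PG_star (PG_class (dom_edge g)).
  exact: (congr1 sval (eta_funS g)).
rewrite mul_star eta_fixl !sE -lM.
by split=> [/(congr1 (@PG_star P))|->//]; rewrite !lK.
Qed.

(** By [eta_fixl] and [eta_fixr] the same products are defined on both sides.
    The product in PG is idempotent, so it is determined by its ends, and these
    are given by the formula of [dom_mul]. *)
Lemma eta_funM e f : bmul (eta_fun e) (eta_fun f) = omap eta_fun (bmul e f).
Proof.
have basic e1 e2 : (exists g, bmul e1 e2 = Some g) <->
    basic_pair (sval (eta_fun e1)) (sval (eta_fun e2)).
  by rewrite mul_basic !eta_fixl !eta_fixr.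
case E12: (bmul e f) => [g|] /=; last first.
  case E12': (bmul _ _) => [c|] //.
  have /boset_mulP[/basic[g gE] _] := E12'.
  by rewrite gE in E12.
have b : basic_pair (sval (eta_fun e)) (sval (eta_fun f)).
  by apply/basic; exists g.
apply: boset_mulI => //=; rewrite /rmul /= PG_mulE.
have := basic_pair_idem b; rewrite /= /rmul /= PG_mulE => /PG_idem_edge[pq ->].
have [s t] := verts_ends (verts_pprod_edge (dom_eqF wP e) (dom_eqF wP f)).
have edgeE p q (h : eqF p q) :
    p = dom g -> q = dom (g^*) -> PG_class (pedge h) = PG_class (dom_edge g).
  by move=> pE qE; congr PG_class; apply: ppath_ext; rewrite /verts /= pE qE.
apply: edgeE; first by rewrite (dom_mul wP E12); exact: s.
by have /mul_star/(dom_mul wP) -> := E12; rewrite !bstarK; exact: t.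
Qed.

Definition eta_inv (c : forget_obj PGE) : E := sval (cid (eta_fun_surj c)).

Lemma eta_invK : cancel eta_inv eta_fun.
Proof. by move=> c; exact: (svalP (cid (eta_fun_surj c))). Qed.

Lemma eta_funK : cancel eta_fun eta_inv.
Proof. by move=> e; apply: eta_fun_inj; exact: eta_invK. Qed.

Definition eta : rsbs_hom E (forget_obj PGE) :=
  rsbs_hom_bij eta_funK eta_invK eta_funM eta_funS.

Lemma eta_iso : exists v : rsbs_hom (forget_obj PGE) E,
  rsbs_comp eta v = rsbs_id E /\ rsbs_comp v eta = rsbs_id (forget_obj PGE).
Proof.
exists (rsbs_hom_bij eta_invK eta_funK
  (boset_bij_inv eta_funK eta_invK eta_funM)
  (boset_bij_invS eta_funK eta_invK eta_funS)).
by split; apply: rsbs_hom_ext => e; [exact: eta_funK|exact: eta_invK].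
Qed.

Lemma eta_proj (p : P) : sval (eta (sval p)) = PG_one p.
Proof.
rewrite /= PG_edgeE -(svalP p) !dom_proj; exact: (repr_idem (PG_one_repr P)).
Qed.

End Object.

Lemma eta_natural (E E' : rsbs) (phi : rsbs_hom E E') :
  rsbs_comp phi (eta E') =
  rsbs_comp (eta E) (forget_hom (PG_hom wG (P_hom wP phi))).
Proof.
apply: rsbs_hom_ext => e; apply: idempotent_inj => /=.
rewrite PG_mapE; congr PG_class; apply: ppath_ext.
by rewrite /verts /= -rsbs_funS !(dom_hom wP).
Qed.

(** * Extension of morphisms to PG(P(E)) and the adjunction *)

Section Extension.
Variables (E : rsbs) (S : rss) (k : rsbs_hom E (forget_obj S)).
Local Notation P := (P_obj wP E).
Local Notation "a * b" := (rmul a b).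
Local Notation "a ^*" := (rstar a).

Definition ext_gen (p : P) : rss_semigroup S := sval (k (sval p)).

Lemma ext_gen_star (p : P) : (ext_gen p)^* = ext_gen p.
Proof.
by have := congr1 sval (rsbs_funS k (sval p)); rewrite -(svalP p) => /esym.
Qed.

(** Write a, b for the images of p, q and x for that of e(p, q), so that a x is
    the image r of q theta_p.  Since k preserves sandwich sets, a x b = a b.
    Then a b a and r are projections in the same R-class of S, hence equal. *)
Lemma ext_gen_repr : representation ext_gen.
Proof.
have idem p : ext_gen p * ext_gen p = ext_gen p by exact: (svalP (k (sval p))).
have sq p q :
    ext_gen p * ext_gen q * (ext_gen p * ext_gen q) = ext_gen p * ext_gen q.
  rewrite -[RHS]rmulR rstarM !ext_gen_star !rmulA.
  rewrite -(rmulA _ (ext_gen q) (ext_gen q)) idem.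
  by rewrite -(rmulA _ (ext_gen p) (ext_gen p)) idem.
split=> // p q; change (ext_gen p * ext_gen q * ext_gen p = ext_gen (q |> p)).
have /proj_thetaP[e [[W _ _] per]] := erefl (q |> p).
have /sandwichE[/= ep qe peq] := rsbs_funW k W.
have /boset_mulP[_ /= rE] := rsbs_funM k per.
move: (sval (k e)) ep qe peq rE => x ep qe peq rE.
have {}rE : ext_gen (q |> p) = ext_gen p * x := rE.
move: (ext_gen_star p) (ext_gen_star q) (ext_gen_star (q |> p)) (sq p q).
move: rE ep qe peq; rewrite -/(ext_gen p) -/(ext_gen q).
move: (ext_gen p) (ext_gen q) (ext_gen (q |> p)) (idem p) => a b r aa.
move=> rE xa bx axb aS bS rS ab.
have h1 : a * b * a * r = r.
  have -> : r = a * b * x by rewrite rE -[in LHS]bx rmulA.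
  by rewrite !rmulA -(rmulA _ a a) aa -(rmulA (a * b)) ab.
have h2 : r * (a * b * a) = a * b * a.
  by rewrite rE !rmulA -(rmulA a x a) xa axb.
have := congr1 (@rstar S) h1; rewrite !rstarM rS aS bS.
by rewrite (rmulA a b a) h2.
Qed.

Definition ext_fun (c : PG P) : S := path_prod ext_gen (PG_repr c).

Lemma ext_funE (a : ppath P) : ext_fun (PG_class a) = path_prod ext_gen a.
Proof. exact/(path_prod_cong ext_gen_repr)/PG_repr_cong. Qed.

Lemma ext_funM c d : ext_fun (PG_mul c d) = ext_fun c * ext_fun d.
Proof.
by rewrite [PG_mul c d]/PG_mul ext_funE (path_prod_pprod _ _ ext_gen_repr).
Qed.

Lemma ext_funS c : ext_fun (PG_star c) = (ext_fun c)^*.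
Proof.
rewrite [PG_star c]/PG_star ext_funE /ext_fun.
rewrite -(path_prod_prev (S := rss_semigroup S)) prevK /path_prod.
elim: (rest _) (src _) => [|q s IHs] p /=; first by rewrite ext_gen_star.
by rewrite IHs [RHS]rstarM ext_gen_star.
Qed.

Definition ext_hom : rss_hom (PG_obj wG P) S :=
  @RssHom (PG_obj wG P) S ext_fun ext_funM ext_funS.

(** The image x of e satisfies x x^* = s and x^* x = t, with s, t the images of
    the two projections of e, and x is idempotent; so s t = x (x x)^* x = x. *)
Lemma ext_homE : rsbs_comp (eta E) (forget_hom ext_hom) = k.
Proof.
apply: rsbs_hom_ext => e; apply: idempotent_inj => /=; rewrite ext_funE.
rewrite /path_prod /=.
have fixed g : ext_gen (dom wP g) * sval (k g) = sval (k g) /\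
    sval (k g) * ext_gen (dom wP g) = ext_gen (dom wP g).
  by have [/(rsbs_funM k)/boset_mulP[_ h1] /(rsbs_funM k)/boset_mulP[_ h2]] :=
    domP wP g.
have [] := fixed e; have [] := fixed (bstar e).
have -> : sval (k (bstar e)) = (sval (k e))^* := congr1 sval (rsbs_funS k e).
have xx : sval (k e) * sval (k e) = sval (k e) := svalP (k e).
move: (ext_gen_star (dom wP e)) (ext_gen_star (dom wP (bstar e))) xx.
move: (ext_gen (dom wP e)) (ext_gen (dom wP (bstar e))) (sval (k e)) => s t x.
move=> sS tS xx tx xt sx xs.
have {}xt : t * x = t by have := congr1 (@rstar S) xt; rewrite rstarM rstarK tS.
have {}tx : x * t = x by have := congr1 (@rstar S) tx; rewrite rstarM rstarK tS.
have sE : s = x * x^*.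
  have h : x * x^* * s = s by rewrite -[in LHS]xs rmulA rmulR xs.
  have := congr1 (@rstar S) h; rewrite !rstarM rstarK sS => <-.
  by rewrite rmulA sx.
have tE : t = x^* * x.
  have h : t * (x^* * x) = t.
    by rewrite -[in LHS]xt rmulA -(rmulA t) -rmulA rmulR xt.
  have := congr1 (@rstar S) h; rewrite !rstarM rstarK tS => <-.
  by rewrite -rmulA tx.
by change (s * t = x); rewrite sE tE rmulA -(rmulA x) -rstarM xx rmulR.
Qed.

End Extension.

(** PG(P(E)) is generated by the images of the projections of E. *)
Lemma eta_ext (E : rsbs) (S : rss) (u v : rss_hom (PG_obj wG (P_obj wP E)) S) :
  rsbs_comp (eta E) (forget_hom u) = rsbs_comp (eta E) (forget_hom v) -> u = v.
Proof.
move=> uv; apply: rss_hom_ext => c.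
have one p : u (PG_one p) = v (PG_one p).
  have := congr1 (fun h : rsbs_hom _ (forget_obj S) => sval (h (sval p))) uv.
  by rewrite -!eta_proj.
rewrite -(PG_reprK c) -path_prod_PG_one /path_prod.
elim: (rest _) (src _) => [|q s IHs] p /=; first exact: one.
by rewrite !(rss_funM (S := PG_obj wG (P_obj wP E)) _ (PG_one p)) one IHs.
Qed.

Lemma unit_adjunction : left_adjoint
  (functor_comp (P_functor wP) (PG_functor wG)) forget.
Proof.
exists (fun (E : RSBS) (S : RSS) (h : rss_hom _ S) =>
  rsbs_comp (eta E) (forget_hom h)).
split.
  move=> E S; exists (@ext_hom E S) => [h|k]; last exact: ext_homE.
  by apply: eta_ext; rewrite ext_homE.
move=> E E' S S' f h g /=.
apply: rsbs_hom_ext => e; apply: idempotent_inj.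
pose T := forget_obj (PG_obj wG (P_obj wP E)).
have := congr1 (fun m : rsbs_hom E' T => sval (m e)) (eta_natural f).
by move=> /= ->.
Qed.

End Unit.

(** * The left adjoint is fully faithful *)

Section FullyFaithful.
Variables (C D : category) (F : functor C D).

Lemma fully_faithful_reflects_iso : faithful F -> full F ->
  forall a b : C, isomorphic (F a) (F b) -> isomorphic a b.
Proof.
move=> Ffaith Ffull a b [u [v [uv vu]]].
have [f fu] := Ffull _ _ u; have [g gv] := Ffull _ _ v.
exists f, g; split; apply: Ffaith; by rewrite fmap_comp fu gv fmap_id.
Qed.
End FullyFaithful.

Section UnitFullyFaithful.
Variables (wP : P_well_defined) (wG : PG_well_defined).
Let F := functor_comp (P_functor wP) (PG_functor wG).

Lemma PG_P_faithful : faithful F.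
Proof.
move=> E E' f g fg; have [v [ev _]] := eta_iso wP wG E'.
have vK e : v (eta wP wG E' e) = e := congr1 (fun m : rsbs_hom E' E' => m e) ev.
have fg' : rsbs_comp f (eta wP wG E') = rsbs_comp g (eta wP wG E').
  by rewrite !eta_natural; congr (rsbs_comp _ (forget_hom _)); exact: fg.
apply: rsbs_hom_ext => e; rewrite -(vK (f e)) -(vK (g e)); congr (v _).
exact: (congr1 (fun m : rsbs_hom E _ => m e) fg').
Qed.

Lemma PG_P_full : full F.
Proof.
move=> E E' g; have [v [_ ve]] := eta_iso wP wG E'.
have vK y : eta wP wG E' (v y) = y := congr1 (fun m : rsbs_hom _ _ => m y) ve.
exists (rsbs_comp (rsbs_comp (eta wP wG E) (forget_hom g)) v).
apply: eta_ext; rewrite -eta_natural.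
by apply: rsbs_hom_ext => e; exact: vK.
Qed.
End UnitFullyFaithful.

(** * Functors and adjunctions on induced categories *)

(** Isomorphisms as data: [isomorphic] is a proposition and does not yield an
    inverse from which functors can be built. *)
Record iso (C : category) (a b : C) := Iso {
  fw : hom a b; bw : hom b a;
  fwK : comp fw bw = idm a; bwK : comp bw fw = idm b }.

(** A functor F followed by the replacement of each F (f1 a) by an isomorphic
    object in the image of f2. *)
Section InducedFunctor.
Variables (C D : category) (F : functor C D).
Variables (O1 O2 : Type) (f1 : O1 -> C) (f2 : O2 -> D) (I : O1 -> O2).
Variable alpha : forall a, iso (F (f1 a)) (f2 (I a)).

Definition induced_fmap (a b : O1) (h : hom (f1 a) (f1 b)) :
    hom (f2 (I a)) (f2 (I b)) :=
  comp (comp (bw (alpha a)) (fmap F h)) (fw (alpha b)).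

Lemma induced_fmap_id a : induced_fmap (idm (f1 a)) = idm (f2 (I a)).
Proof. by rewrite /induced_fmap fmap_id comp_idr bwK. Qed.

Lemma induced_fmap_comp a b c (h : hom (f1 a) (f1 b)) (k : hom (f1 b) (f1 c)) :
  induced_fmap (comp h k) = comp (induced_fmap h) (induced_fmap k).
Proof.
rewrite /induced_fmap fmap_comp -!compA; congr (comp _ (comp _ _)).
by rewrite !compA fwK comp_idl.
Qed.

Definition induced_functor :
    functor (induced_category f1) (induced_category f2) :=
  @Functor (induced_category f1) (induced_category f2) I induced_fmap
    induced_fmap_id induced_fmap_comp.

Lemma induced_fmapK a b (h : hom (f1 a) (f1 b)) :
  comp (fw (alpha a)) (comp (induced_fmap h) (bw (alpha b))) = fmap F h.
Proof. by rewrite /induced_fmap -!compA fwK comp_idr compA fwK comp_idl. Qed.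

Lemma induced_faithful : faithful F -> faithful induced_functor.
Proof.
move=> Ffaith a b h k hk; apply: Ffaith.
by rewrite -!induced_fmapK; congr (comp _ (comp _ _)); exact: hk.
Qed.

Lemma induced_full : full F -> full induced_functor.
Proof.
move=> Ffull a b g.
have [h hg] := Ffull _ _ (comp (comp (fw (alpha a)) g) (bw (alpha b))).
exists h; rewrite /= /induced_fmap hg -!compA bwK comp_idr compA bwK.
exact: comp_idl.
Qed.
End InducedFunctor.

Lemma induced_adjoint (C D : category) (F : functor C D) (G : functor D C)
    (O1 O2 : Type) (f1 : O1 -> C) (f2 : O2 -> D) (I : O1 -> O2) (J : O2 -> O1)
    (alpha : forall a, iso (F (f1 a)) (f2 (I a)))
    (beta : forall b, iso (G (f2 b)) (f1 (J b))) :
  left_adjoint F G ->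
  left_adjoint (induced_functor alpha) (induced_functor beta).
Proof.
case=> phi [phi_bij phi_nat].
exists (fun a b (h : hom (f2 (I a)) (f2 b)) =>
  comp (phi _ _ (comp (fw (alpha a)) h)) (fw (beta b))); split.
  move=> a b; have [psi phiK psiK] := phi_bij (f1 a) (f2 b).
  exists (fun k : hom (f1 a) (f1 (J b)) =>
    comp (bw (alpha a)) (psi (comp k (bw (beta b))))) => h.
    rewrite -compA fwK comp_idr phiK compA bwK; exact: comp_idl.
  by rewrite compA fwK comp_idl psiK -compA bwK; exact: comp_idr.
move=> a a' b b' f h g; rewrite /= /induced_fmap.
have -> : comp (fw (alpha a')) (comp (comp
    (comp (comp (bw (alpha a')) (fmap F f)) (fw (alpha a))) h) g) =
  comp (comp (fmap F f) (comp (fw (alpha a)) h)) g.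
  by rewrite !compA fwK comp_idl.
rewrite phi_nat -!compA; do 2 congr (comp _ _).
by rewrite [in RHS]compA fwK comp_idl.
Qed.

(** * Transport of structures along bijections *)
Section Transport.
Variables (T T' : Type) (h : T -> T') (k : T' -> T).
Hypotheses (hK : cancel h k) (kK : cancel k h).

Section TransportRss.
Variable s : rss_on T.
Let X : rss := Rss s.
Definition transport_mul (a b : T') : T' := h (rmul (k a : X) (k b)).
Definition transport_star (a : T') : T' := h (rstar (k a : X)).

Lemma transport_rss_laws : rss_laws transport_mul transport_star.
Proof.
rewrite /transport_mul /transport_star; split=> [a b c|a|a|a b]; rewrite ?hK.
- by rewrite (rmulA (S := X)).
- by rewrite (rstarK (S := X)) kK.
- by rewrite (rmulR (S := X)) kK.
- by rewrite (rstarM (S := X)).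
Qed.

Definition transport_rss : rss_on T' := RssOn transport_rss_laws.

Definition transport_rss_fw : rss_hom X (Rss transport_rss).
Proof.
refine (@RssHom X (Rss transport_rss) h _ _) => [a b|a];
  by rewrite /rmul /rstar /= /transport_mul /transport_star !hK.
Defined.

Definition transport_rss_bw : rss_hom (Rss transport_rss) X.
Proof.
refine (@RssHom (Rss transport_rss) X k _ _) => [a b|a];
  by rewrite /rmul /rstar /= /transport_mul /transport_star !hK.
Defined.

Definition transport_rss_iso : iso (C := RSS) X (Rss transport_rss).
Proof.
refine (@Iso RSS X (Rss transport_rss) transport_rss_fw transport_rss_bw _ _).
  by apply: rss_hom_ext => a; exact: hK.
by apply: rss_hom_ext => a; exact: kK.
Defined.
End TransportRss.

Section TransportRsbs.
Variable s : rsbs_on T.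
Let X : rsbs := Rsbs s.
Definition transport_bmul (a b : T') : option T' :=
  omap h (bmul (k a : X) (k b)).
Definition transport_bstar (a : T') : T' := h (bstar (k a : X)).

Lemma transport_bmulE (a b c : T) :
  bmul (a : X) b = Some c -> transport_bmul (h a) (h b) = Some (h c).
Proof. by rewrite /transport_bmul !hK => ->. Qed.

Lemma transport_bmulI a b c :
  transport_bmul a b = Some c -> bmul (k a : X) (k b) = Some (k c).
Proof. by rewrite /transport_bmul; case: bmul => //= d [<-]; rewrite hK. Qed.

Lemma transport_rsbs_laws : rsbs_laws transport_bmul transport_bstar.
Proof.
have [[S [Sreg [i [[j ij ji] iM]]]] lK lM lBP lE] := rsbs_onP s.
split.
- exists S; split=> //; exists (i \o k); split.
    by exists (h \o j) => a /=; rewrite ?ij ?kK // hK ji.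
  move=> e f; rewrite /= iM /transport_bmul.
  by rewrite -[rsbs_on_mul s]/(@bmul X); case: bmul => //= g; rewrite hK.
- by move=> e; rewrite /transport_bstar hK [bstar (bstar _)]lK kK.
- by move=> e f g /transport_bmulI/lM/transport_bmulE.
- move=> e f [g /transport_bmulI efg].
  have [|x /transport_bmulE xE] := lBP (k e) (k f); first by exists (k g).
  by exists (h x).
- move=> e; have [s0 [t0 [[h1 h2 h3 h4] [[h5 h6 h7 h8] sq]]]] := lE (k e).
  exists (h s0), (h t0).
  have ke : h (k e) = e by exact: kK.
  split; [|split].
  + by split; [move/transport_bmulE: h1|move/transport_bmulE: h2
      |move/transport_bmulE: h3|move/transport_bmulE: h4]; rewrite ?ke.
  + by split; [move/transport_bmulE: h5|move/transport_bmulE: h6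
      |move/transport_bmulE: h7|move/transport_bmulE: h8]; rewrite ?ke.
  + move=> g /transport_bmulI ge /transport_bmulI eg.
    have [gs [tg [c [/transport_bmulE m1 /transport_bmulE m2
      /transport_bmulE m3 /transport_bmulE m4]]]] := sq (k g) ge eg.
    by exists (h gs), (h tg), (h c); rewrite !kK in m1 m2.
Qed.

Definition transport_rsbs : rsbs_on T' := RsbsOn transport_rsbs_laws.

Lemma transport_rsbsM (e f : X) :
  bmul (h e : Rsbs transport_rsbs) (h f) = omap h (bmul e f).
Proof.
change (transport_bmul (h e) (h f) = omap h (bmul e f)).
by rewrite /transport_bmul !hK.
Qed.

Lemma transport_rsbsS (e : X) : h (bstar e) = bstar (h e : Rsbs transport_rsbs).
Proof.
change (h (bstar e) = transport_bstar (h e)).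
by rewrite /transport_bstar hK.
Qed.

Definition transport_rsbs_iso : iso (C := RSBS) X (Rsbs transport_rsbs).
Proof.
pose Y : rsbs := Rsbs transport_rsbs.
refine (@Iso RSBS X Y
  (@rsbs_hom_bij X Y h k hK kK transport_rsbsM transport_rsbsS)
  (@rsbs_hom_bij Y X k h kK hK
    (@boset_bij_inv X Y h k hK kK transport_rsbsM)
    (@boset_bij_invS X Y h k hK kK transport_rsbsS)) _ _).
  apply: rsbs_hom_ext; exact: hK.
apply: rsbs_hom_ext; exact: kK.
Defined.
End TransportRsbs.
End Transport.

(** * Structures on subsets of a fixed type *)
Section Image.
Variables (U T : Type) (j : T -> U).
Hypothesis j_inj : injective j.

Definition image_set : set U := [set u | exists t, j t = u].

Lemma image_setP t : j t \in image_set.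
Proof. by apply/mem_set; exists t. Qed.

Definition to_image (t : T) : image_set := exist _ (j t) (image_setP t).

Lemma image_ex (a : image_set) : exists t, j t = val a.
Proof. by case: a => u /= /set_mem. Qed.

Definition of_image (a : image_set) : T := sval (cid (image_ex a)).

Lemma of_imageK : cancel of_image to_image.
Proof. by move=> a; apply: val_inj; exact: (svalP (cid (image_ex a))). Qed.

Lemma to_imageK : cancel to_image of_image.
Proof.
by move=> t; apply: j_inj; exact: (svalP (cid (image_ex (to_image t)))).
Qed.
End Image.

Section InType.
Variable U : Type.

(** As relations on U, the graphs of the operations can be compared between
    structures on sets that are not known to be equal. *)
Definition mul_graph (X : {A : set U & rsbs_on A}) (x y z : U) : Prop :=
  exists e f g : projT1 X, [/\ val e = x, val f = y, val g = z &
    rsbs_on_mul (projT2 X) e f = Some g].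

Definition star_graph (X : {A : set U & rsbs_on A}) (x y : U) : Prop :=
  exists e f : projT1 X,
    [/\ val e = x, val f = y & rsbs_on_star (projT2 X) e = f].

Lemma graph_inj (X X' : {A : set U & rsbs_on A}) :
  (forall x y z, mul_graph X x y z <-> mul_graph X' x y z) ->
  (forall x y, star_graph X x y <-> star_graph X' x y) -> X = X'.
Proof.
case: X X' => [A [m s l]] [A' [m' s' l']] mG sG.
have AA' : A = A'.
  have h (B : set U) E x : B x <->
      exists y, star_graph (existT (fun C : set U => rsbs_on C) B E) x y.
    split=> [/mem_set Bx|[y [[u uB] [f [/= <- _ _]]]]]; last exact: set_mem.
    pose b : set_type B := exist _ x Bx.
    by exists (val (rsbs_on_star E b)), b, (rsbs_on_star E b).
  apply/seteqP; split=> x.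
    by move=> /(h _ (RsbsOn l))[y /sG xy]; apply/(h _ (RsbsOn l')); exists y.
  by move=> /(h _ (RsbsOn l'))[y /sG xy]; apply/(h _ (RsbsOn l)); exists y.
subst A'.
have ss : s = s'.
  apply: funext => e; apply: val_inj.
  have /sG[e' [f' [/val_inj/= -> /= <- <-//]]] :
    star_graph (existT _ A (RsbsOn l)) (val e) (val (s e)) by exists e, (s e).
have mul_le (m1 m2 : A -> A -> option A) s1 s2
    (l1 : rsbs_laws m1 s1) (l2 : rsbs_laws m2 s2) :
    (forall x y z, mul_graph (existT _ A (RsbsOn l1)) x y z ->
      mul_graph (existT _ A (RsbsOn l2)) x y z) ->
    forall e f g, m1 e f = Some g -> m2 e f = Some g.
  move=> h e f g efg.
  have /h[e' [f' [g' [/val_inj/= <- /val_inj/= <- /val_inj/= <- //]]]] :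
    mul_graph (existT _ A (RsbsOn l1)) (val e) (val f) (val g).
  by exists e, f, g.
have mm' := mul_le _ _ _ _ _ _ (fun x y z => proj1 (mG x y z)).
have m'm := mul_le _ _ _ _ _ _ (fun x y z => proj2 (mG x y z)).
have mm : m = m'.
  apply: funext => e; apply: funext => f.
  case E1: (m e f) => [g|]; first by rewrite (mm' _ _ _ E1).
  by case E2: (m' e f) => [g|//]; rewrite (m'm _ _ _ E2) in E1.
by subst s' m'; rewrite (Prop_irrelevance l l').
Qed.
End InType.

(** * Injectivity on objects by coding paths *)

Section Coding.
Variables (wP : P_well_defined) (wG : PG_well_defined).
Variables (U : Type) (code : seq U -> U).
Hypothesis code_inj : injective code.

Section Object.
Variable X : {A : set U & rsbs_on A}.
Local Notation E := (Rsbs (projT2 X)).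
Local Notation P := (P_obj wP E).
Local Notation PGE := (PG_obj wG P).
Local Notation eta := (eta wP wG E).

Definition val_proj (p : P) : U := val (sval p).

Lemma val_proj_inj : injective val_proj.
Proof. by move=> p q /val_inj pq; exact: (@proj_inj E p q pq). Qed.

(** Idempotents and other elements cannot collide: the path that represents an
    element other than an idempotent has more than one vertex. *)
Definition code_PG (c : PG P) : U :=
  match pselect (PG_mul c c = c) with
  | left cc =>
      code [:: val (eta_inv (Idempotent (S := rss_semigroup PGE) cc))]
  | right _ => code (map val_proj (verts (PG_repr c)))
  end.

Lemma code_PG_eta (e : E) : code_PG (sval (eta e)) = code [:: val e].
Proof.
rewrite /code_PG; case: pselect => [cc|]; last by case; exact: (svalP (eta e)).
congr (code [:: val _]).
have -> : Idempotent (S := rss_semigroup PGE) cc = eta e.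
  exact: idempotent_inj.
exact: (eta_funK wP wG e).
Qed.

Lemma code_PGP (c : PG P) : (exists e, c = sval (eta e)) \/
  (1 < size (verts (PG_repr c)) /\
   code_PG c = code (map val_proj (verts (PG_repr c)))).
Proof.
rewrite /code_PG; case: pselect => [cc|ncc].
  left; exists (eta_inv (Idempotent (S := rss_semigroup PGE) cc)).
  by have /(congr1 sval) := eta_invK (Idempotent (S := rss_semigroup PGE) cc).
right; split=> //; case E1: (rest (PG_repr c)) => [|q s]; last first.
  by rewrite /verts E1.
case: ncc; have -> : c = PG_one (src (PG_repr c)).
  rewrite -[LHS]PG_reprK; congr PG_class; apply: ppath_ext.
  by rewrite /verts E1.
exact: (repr_idem (PG_one_repr P)).
Qed.

Lemma code_PG_inj : injective code_PG.
Proof.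
move=> c d; case: (code_PGP c) => [[e ->]|[sc ->]].
  rewrite code_PG_eta; case: (code_PGP d) => [[f ->]|[sd ->]].
    by rewrite code_PG_eta => /code_inj[/val_inj ->].
  by move=> /code_inj; move: sd; case: (verts _) => [|x [|y s]].
case: (code_PGP d) => [[f ->]|[sd ->]].
  by rewrite code_PG_eta => /code_inj; move: sc; case: (verts _) => [|x [|y s]].
move=> /code_inj/(inj_map val_proj_inj)/ppath_ext cd.
by rewrite -(PG_reprK c) cd PG_reprK.
Qed.

Lemma code_PG_seq1 c x : code_PG c = code [:: x] <->
  exists e, val e = x /\ c = sval (eta e).
Proof.
split=> [|[e [<- ->]]]; last exact: code_PG_eta.
case: (code_PGP c) => [[e ->]|[sc ->]].
  by rewrite code_PG_eta => /code_inj[<-]; exists e.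
by move=> /code_inj; move: sc; case: (verts _) => [|y [|z s]].
Qed.

Definition PG_in : {A : set U & rss_on A} :=
  existT (fun A : set U => rss_on A) (image_set code_PG)
    (transport_rss (to_imageK code_PG_inj) (@of_imageK _ _ code_PG)
      (rss_str PGE)).

Definition PG_in_iso : iso (C := RSS) PGE (Rss (projT2 PG_in)) :=
  transport_rss_iso (to_imageK code_PG_inj) (@of_imageK _ _ code_PG)
    (rss_str PGE).

End Object.

Definition coded_mul (Y : {B : set U & rss_on B}) (x y z : U) : Prop :=
  let S := Rss (projT2 Y) in exists a b c : projT1 Y,
  [/\ val a = code [:: x], val b = code [:: y], val c = code [:: z],
     basic_pair (a : rss_semigroup S) b & @rmul S a b = c].

Definition coded_star (Y : {B : set U & rss_on B}) (x y : U) : Prop :=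
  exists a b : projT1 Y, [/\ val a = code [:: x], val b = code [:: y]
    & @rstar (Rss (projT2 Y)) a = b].

Section Recover.
Variable X : {A : set U & rsbs_on A}.
Local Notation E := (Rsbs (projT2 X)).
Local Notation P := (P_obj wP E).
Local Notation PGE := (PG_obj wG P).
Local Notation eta := (eta wP wG E).
Local Notation Y := (Rss (projT2 (PG_in X))).
Let h : rss_hom PGE Y := fw (PG_in_iso X).
Let k : rss_hom Y PGE := bw (PG_in_iso X).

Let hK : cancel h k. Proof. exact: (to_imageK (@code_PG_inj X)). Qed.
Let kK : cancel k h. Proof. exact: (@of_imageK _ _ (@code_PG X)). Qed.

Lemma val_fw c : val (h c : projT1 (PG_in X)) = code_PG c.
Proof. by []. Qed.

Lemma val_seq1 (a : projT1 (PG_in X)) x : val a = code [:: x] ->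
  exists e : E, val e = x /\ a = h (sval (eta e)).
Proof.
rewrite -[a](kK a : h (k a) = a) val_fw => /code_PG_seq1[e [ex ke]].
by exists e; rewrite -ke.
Qed.

Lemma basic_pair_hom (S S' : rss) (f : rss_hom S S') (a b : S) :
  basic_pair (a : rss_semigroup S) b ->
  basic_pair (f a : rss_semigroup S') (f b).
Proof. by rewrite /basic_pair /= -!rss_funM; case=> -[]->; tauto. Qed.

Lemma mul_graphE x y z : mul_graph X x y z <-> coded_mul (PG_in X) x y z.
Proof.
split=> [[e [f [g [<- <- <- efg]]]]|].
  have {}efg : bmul (e : E) f = Some g := efg.
  have /boset_mulP[b gE] := rsbs_funM eta efg.
  exists (h (sval (eta e))), (h (sval (eta f))), (h (sval (eta g))).
  rewrite !val_fw !code_PG_eta; split=> //; first exact: basic_pair_hom.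
  by rewrite gE; exact/esym/(rss_funM h).
case=> a [b [c [/val_seq1[e [ex ->]] /val_seq1[f [fy ->]]]]].
move=> /val_seq1[g [gz ->]].
move=> /(basic_pair_hom k); rewrite !hK => ef efg.
exists e, f, g; split=> //.
have : bmul (eta e) (eta f) = Some (eta g).
  apply: boset_mulI => //; apply: (can_inj hK); rewrite -efg.
  exact: (rss_funM h).
have -> : bmul (eta e) (eta f) = omap eta (bmul e f) by exact: eta_funM.
rewrite -[rsbs_on_mul _ e f]/(bmul (e : E) f); case: bmul => [g'|//] /= gg.
by rewrite (eta_fun_inj (congr1 (odflt (eta g)) gg)).
Qed.

Lemma star_graphE x y : star_graph X x y <-> coded_star (PG_in X) x y.
Proof.
split=> [[e [f [<- <- ef]]]|].
  have {}ef : bstar (e : E) = f := ef.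
  exists (h (sval (eta e))), (h (sval (eta f))).
  rewrite !val_fw !code_PG_eta; split=> //.
  rewrite -ef rsbs_funS; exact/esym/(rss_funS h).
case=> a [b [/val_seq1[e [ex ->]] /val_seq1[f [fy ->]] ef]].
exists e, f; split=> //; apply: (@eta_fun_inj wP wG E); apply: idempotent_inj.
apply: (can_inj hK); rewrite -[RHS]ef -(rss_funS h); congr (h _).
exact: (congr1 sval (rsbs_funS eta e)).
Qed.
End Recover.

Lemma PG_in_inj : injective PG_in.
Proof.
move=> X X' XX'; apply: graph_inj => [x y z|x y].
  by rewrite !mul_graphE XX'.
by rewrite !star_graphE XX'.
Qed.

Lemma val_idempotent_inj (B : set U) (s : rss_on B) :
  injective (fun c : forget_obj (Rss s) => val (sval c : B)).
Proof.
by move=> c d /val_inj cd; exact: (@idempotent_inj (rss_semigroup (Rss s))).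
Qed.

Definition forget_in (Y : {B : set U & rss_on B}) : {A : set U & rsbs_on A} :=
  existT (fun A : set U => rsbs_on A) _
    (transport_rsbs (to_imageK (@val_idempotent_inj (projT1 Y) (projT2 Y)))
      (@of_imageK _ _ _) (rsbs_str (forget_obj (Rss (projT2 Y))))).

Definition forget_in_iso (Y : {B : set U & rss_on B}) :
    iso (C := RSBS) (forget_obj (Rss (projT2 Y)))
      (Rsbs (projT2 (forget_in Y))) :=
  transport_rsbs_iso (to_imageK (@val_idempotent_inj (projT1 Y) (projT2 Y)))
    (@of_imageK _ _ _) (rsbs_str (forget_obj (Rss (projT2 Y)))).

Lemma coreflective_in : coreflective (RSBS_in U) (RSS_in U).
Proof.
exists (induced_functor (F := functor_comp (P_functor wP) (PG_functor wG))
  PG_in_iso); split.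
  split; first exact: PG_in_inj.
    by apply: induced_faithful; exact: PG_P_faithful.
  by apply: induced_full; exact: PG_P_full.
exists (induced_functor (F := forget) forget_in_iso).
by apply: induced_adjoint; exact: unit_adjunction.
Qed.
End Coding.

Theorem theorem6p20 :
  (exists (wP : P_well_defined) (wG : PG_well_defined),
     left_adjoint (functor_comp (P_functor wP) (PG_functor wG)) forget) /\
  coreflective_iso RSBS RSS /\
  (forall (U : Type) (code : seq U -> U),
     injective code -> coreflective (RSBS_in U) (RSS_in U)).
Proof.
pose wP := P_is_well_defined; pose wG := PG_is_well_defined.
split; [|split].
- by exists wP, wG; exact: unit_adjunction.
- exists (functor_comp (P_functor wP) (PG_functor wG)); split.
    split; [|exact: PG_P_faithful|exact: PG_P_full].
    apply: fully_faithful_reflects_iso; [exact: PG_P_faithful|exact: PG_P_full].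
  by exists forget; exact: unit_adjunction.
- by move=> U code code_inj; exact: (coreflective_in wP wG code_inj).
Qed.
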